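(* Let $\mathcal{M}$ be a smooth manifold, and for each $i\in\{1,\dots,N\}$ let $\{f_{i,j}\}_{j=1}^{d_i}$ be smooth vector fields on $\mathcal{M}$ and $J_i:\mathcal{M}\to\mathbb{R}$ a smooth function. Let $\mathcal{U}\subset\mathcal{M}$ be an open submanifold on which the following hold, with $\mathcal{E}_i(x):=\mathrm{span}_{\mathbb{R}}\{f_{i,j}(x)\}_{j=1}^{d_i}$: (1) each $\mathcal{E}_i$ is a regular distribution and $T_x\mathcal{U}=\mathcal{E}_1(x)\oplus\cdots\oplus\mathcal{E}_N(x)$ for all $x\in\mathcal{U}$; (2) for each $i$, $\{f_{i,j}\}_{j=1}^{d_i}$ is linearly independent at every $x\in\mathcal{U}$; (3) for each $i$ and all $p,q\in\{1,\dots,d_i\}$, $[f_{i,p},f_{i,q}]\in\mathrm{span}\{f_{i,r}\}_{r=1}^{d_i}$ (i.e. $[f_{i,p},f_{i,q}]$ takes values in $\mathcal{E}_i$). Let $x^\star\in\mathcal{U}$ satisfy $\mathrm{grad}_{\mathcal{E}_i}(J_i)|_{x^\star}=0$ for all $i$. Then, with respect to the frame $\{f_{i,j}\}$, the diagonal blocks of the matrix of $A|_{x^\star}$ are given by $$(A_{ii}|_{x^\star})_{p,q}=\mathrm{Hess}^i\big(J_i|_{\mathcal{U}_i^\star}\big)[f_{i,p},f_{i,q}]\big|_{x^\star},$$ where $\mathrm{Hess}^i$ is the intrinsic Hessian of the restriction $J_i|_{\mathcal{U}_i^\star}$ computed with respect to the induced metric $g^i$ on the leaf $\mathcal{U}_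i^\star$.
   Context: A regular distribution is a smooth distribution of constant rank. $g$ is the Riemannian metric on $\mathcal{U}$ for which $\{f_{i,j}\}$ is an orthonormal frame, $\nabla$ its Levi-Civita connection, and $\mathrm{grad}_{\mathcal{E}_i}(J)=P_{\mathcal{E}_i}\mathrm{grad}(J)$ the $g$-orthogonal projection of the $g$-gradient onto $\mathcal{E}_i$. The intrinsic Jacobian is the $(1,1)$-tensor $A[X]:=\nabla_X\big(\sum_{i=1}^N\mathrm{grad}_{\mathcal{E}_i}(J_i)\big)$; the blocks $A_{ij}|_{x^\star}\in\mathbb{R}^{d_i\times d_j}$ of its matrix in the frame are determined by $A|_{x^\star}[f_{j,q}(x^\star)]=\sum_{i,p}(A_{ij}|_{x^\star})_{p,q}f_{i,p}(x^\star)$. Each $\mathcal{E}_i$ is integrable by the Frobenius theorem; $\mathcal{U}_i(x)$ denotes the leaf of $\mathcal{E}_i$ through $x$, i.e. the unique maximal connected integral manifold of $\mathcal{E}_i$ in $\mathcal{U}$ through $x$ ($T_y\mathcal{U}_i(x)=\mathcal{E}_i(y)$ for $y\in\mathcal{U}_i(x)$), and $\mathcal{U}_i^\star:=\mathcal{U}_i(x^\star)$. $g^i$ is the metric induced by $g$ on $\mathcal{U}_i^\star$, with Levi-Civita connection $\nabla^i$, and $\mathrm{Hess}^i(h)[X,Y]=g^i(\nabla^i_X\mathrm{grad}^i(h),Y)$, where $\mathrm{grad}^i$ is the $g^i$-gradient. *)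

(* Defs.v *)
From HB Require Import structures.
From mathcomp Require Import all_boot all_order all_algebra.
From mathcomp Require Import all_classical all_reals all_analysis.

Set Implicit Arguments.
Unset Strict Implicit.
Unset Printing Implicit Defensive.

Import Order.TTheory GRing.Theory Num.Theory.
Import numFieldNormedType.Exports.

Local Open Scope classical_set_scope.
Local Open Scope ring_scope.

(* Finite-dimensional smooth manifolds, presented by smooth atlases.  Tangent
   vectors are derivations of smooth germs.  Vector fields, functions, metrics
   and connections are total objects on the manifold; being smooth, a metric, a
   connection, ... is asserted relative to an open set [U], and only the values
   on [U] matter.  This is how an open submanifold is represented. *)

Section Calculus.
Context {R : realType} {V W : normedModType R}.

(* For finite-dimensional V and open A this is the usual class C^k(A). *)
Fixpoint Ck (k : nat) (A : set V) (f : V -> W) : Prop :=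
  match k with
  | 0 => forall x, A x -> {for x, continuous f}
  | k'.+1 => (forall x, A x -> differentiable f x) /\
             forall v, Ck k' A (fun x => 'D_v f x)
  end.

Definition Cinfty (A : set V) (f : V -> W) : Prop := forall k, Ck k A f.

Definition Cinfty_near (p : V) (f : V -> W) : Prop :=
  exists2 A, open_nbhs p A & Cinfty A f.

End Calculus.

Section LinearAlgebra.
Context {R : realType} {V : lmodType R}.

Definition lin_span (k : nat) (b : 'I_k -> V) : set V :=
  [set v | exists c : 'I_k -> R, v = \sum_(j < k) c j *: b j].

Definition lin_indep (k : nat) (b : 'I_k -> V) : Prop :=
  forall c : 'I_k -> R, \sum_(j < k) c j *: b j = 0 -> forall j, c j = 0.

(* V is the internal direct sum of the subspaces E i. *)
Definition direct_sum (N : nat) (E : 'I_N -> set V) : Prop :=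
  (forall v, exists2 w : 'I_N -> V,
     (forall i, E i (w i)) & v = \sum_(i < N) w i) /\
  (forall w : 'I_N -> V, (forall i, E i (w i)) ->
     \sum_(i < N) w i = 0 -> forall i, w i = 0).

End LinearAlgebra.

(* [chart_map] and [chart_inv] are total; they are mutually inverse
   homeomorphisms between [chart_dom] and its image. *)
Record chart (R : realType) (n : nat) (T : topologicalType) := Chart {
  chart_dom : set T;
  chart_map : T -> 'rV[R]_n;
  chart_inv : 'rV[R]_n -> T;
  chart_dom_open : open chart_dom;
  chart_im_open : open (chart_map @` chart_dom);
  chart_mapK : forall x, chart_dom x -> chart_inv (chart_map x) = x;
  chart_map_cts : forall x, chart_dom x -> {for x, continuous chart_map};
  chart_inv_cts : forall u, (chart_map @` chart_dom) u ->
    {for u, continuous chart_inv} }.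

Record manifold (R : realType) (n : nat) := Manifold {
  mcarrier :> topologicalType;
  atlas : set (chart R n mcarrier);
  mhausdorff : hausdorff_space mcarrier;
  msecond_countable : @second_countable mcarrier;
  atlas_cover : forall x, exists2 a, atlas a & chart_dom a x;
  atlas_smooth : forall a b, atlas a -> atlas b ->
    Cinfty (chart_map a @` (chart_dom a `&` chart_dom b))
           (chart_map b \o chart_inv a) }.

Section Smoothness.
Context {R : realType}.

(* h is of class C^oo in a neighbourhood of x *)
Definition smooth_at n (M : manifold R n) (x : M) (h : M -> R) : Prop :=
  forall a, atlas a -> chart_dom a x ->
    Cinfty_near (chart_map a x) (h \o chart_inv a).

Definition smooth_on n (M : manifold R n) (U : set M) (h : M -> R) : Prop :=
  forall x, U x -> smooth_at x h.

Definition smooth_map k n (L : manifold R k) (M : manifold R n)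
    (iota : L -> M) : Prop :=
  continuous iota /\
  forall y a b, atlas a -> chart_dom a y -> atlas b -> chart_dom b (iota y) ->
    Cinfty_near (chart_map a y) (chart_map b \o iota \o chart_inv a).

End Smoothness.

Section TangentSpace.
Context {R : realType} {n : nat} {M : manifold R n}.

(* A derivation of germs at x, encoded as a functional on all functions M -> R.
   The value on functions that are not smooth at x is normalized to 0, so that
   tangent vectors are equal iff they agree on smooth germs.  Locality (equal
   germs have equal values) follows from the Leibniz rule. *)
Definition derivation_at (x : M) (D : (M -> R) -> R) : Prop :=
  [/\ forall (c : R) h k, smooth_at x h -> smooth_at x k ->
        D (fun y => c * h y + k y) = c * D h + D k,
      forall h k, smooth_at x h -> smooth_at x k ->
        D (fun y => h y * k y) = D h * k x + h x * D k
    & forall h, ~ smooth_at x h -> D h = 0].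

Record tangent (x : M) := Tangent {
  tangent_fun :> (M -> R) -> R;
  tangentP : derivation_at x tangent_fun }.

Lemma tangent_ext (x : M) (v w : tangent x) : (forall h, v h = w h) -> v = w.
Proof.
case: v w => v pv [w pw] /= e; have {}e : v = w by apply/funext.
by subst w; congr Tangent; exact: Prop_irrelevance.
Qed.

HB.instance Definition _ (x : M) := gen_eqMixin (tangent x).
HB.instance Definition _ (x : M) := gen_choiceMixin (tangent x).

Fact tangent0_subproof (x : M) : derivation_at x (fun=> 0).
Proof. by split=> *; rewrite ?mulr0 ?mul0r ?addr0. Qed.
Definition tangent0 (x : M) := Tangent (tangent0_subproof x).

Fact tangentN_subproof (x : M) (v : tangent x) :
  derivation_at x (fun h => - v h).
Proof.
case: v => v [lv mv nv] /=; split=> [c h k hh hk|h k hh hk|h hh].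
- by rewrite lv // opprD mulrN.
- by rewrite mv // opprD mulNr mulrN.
- by rewrite nv // oppr0.
Qed.
Definition tangentN (x : M) (v : tangent x) := Tangent (tangentN_subproof v).

Fact tangentD_subproof (x : M) (v w : tangent x) :
  derivation_at x (fun h => v h + w h).
Proof.
case: v w => v [lv mv nv] [w [lw mw nw]] /=.
split=> [c h k hh hk|h k hh hk|h hh].
- by rewrite lv // lw // mulrDr addrACA.
- by rewrite mv // mw // mulrDr mulrDl addrACA.
- by rewrite nv // nw // addr0.
Qed.
Definition tangentD (x : M) (v w : tangent x) :=
  Tangent (tangentD_subproof v w).

Fact tangentZ_subproof (x : M) (c : R) (v : tangent x) :
  derivation_at x (fun h => c * v h).
Proof.
case: v => v [lv mv nv] /=; split=> [d h k hh hk|h k hh hk|h hh].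
- by rewrite lv // mulrDr mulrCA.
- by rewrite mv // mulrDr mulrA mulrCA.
- by rewrite nv // mulr0.
Qed.
Definition tangentZ (x : M) (c : R) (v : tangent x) :=
  Tangent (tangentZ_subproof c v).

Fact tangentDA (x : M) : associative (@tangentD x).
Proof. by move=> u v w; apply: tangent_ext => h /=; rewrite addrA. Qed.
Fact tangentDC (x : M) : commutative (@tangentD x).
Proof. by move=> u v; apply: tangent_ext => h /=; rewrite addrC. Qed.
Fact tangent0D (x : M) : left_id (tangent0 x) (@tangentD x).
Proof. by move=> u; apply: tangent_ext => h /=; rewrite add0r. Qed.
Fact tangentND (x : M) : left_inverse (tangent0 x) (@tangentN x) (@tangentD x).
Proof. by move=> u; apply: tangent_ext => h /=; rewrite addNr. Qed.

HB.instance Definition _ (x : M) := GRing.isZmodule.Build (tangent x)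
  (@tangentDA x) (@tangentDC x) (@tangent0D x) (@tangentND x).

Fact tangentZA (x : M) (a b : R) (v : tangent x) :
  tangentZ a (tangentZ b v) = tangentZ (a * b) v.
Proof. by apply: tangent_ext => h /=; rewrite mulrA. Qed.
Fact tangent1Z (x : M) : left_id 1 (@tangentZ x).
Proof. by move=> v; apply: tangent_ext => h /=; rewrite mul1r. Qed.
Fact tangentZDr (x : M) : right_distributive (@tangentZ x) +%R.
Proof. by move=> a u v; apply: tangent_ext => h /=; rewrite mulrDr. Qed.
Fact tangentZDl (x : M) (v : tangent x) :
  {morph (@tangentZ x)^~ v : a b / a + b}.
Proof. by move=> a b; apply: tangent_ext => h /=; rewrite mulrDl. Qed.

HB.instance Definition _ (x : M) := GRing.Zmodule_isLmodule.Build R (tangent x)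
  (@tangentZA x) (@tangent1Z x) (@tangentZDr x) (@tangentZDl x).

(* The tangent vector that acts on smooth germs by D (0 if D is not a
   derivation there). *)
Definition derivation_vector (x : M) (D : (M -> R) -> R) : tangent x :=
  xget 0 [set v : tangent x | forall h, smooth_at x h -> v h = D h].

Definition vector_field := forall x : M, tangent x.

Definition smooth_field (U : set M) (X : vector_field) : Prop :=
  forall x h, U x -> smooth_at x h -> smooth_at x (fun y => X y h).

Definition lie_bracket (X Y : vector_field) : vector_field := fun x =>
  derivation_vector x
    (fun h => X x (fun y => Y y h) - Y x (fun y => X y h)).

Definition tangent_distribution := forall x : M, set (tangent x).

Definition smooth_distribution (U : set M) (E : tangent_distribution)
    : Prop :=
  forall x, U x -> exists2 V, open_nbhs x V &
    exists k (X : 'I_k -> vector_field), (forall j, smooth_field V (X j)) /\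
      forall y, V y -> E y = lin_span (fun j => X j y).

Definition regular_distribution (U : set M) (E : tangent_distribution) : Prop :=
  smooth_distribution U E /\
  exists r, forall x, U x ->
    exists2 b : 'I_r -> tangent x, lin_indep b & E x = lin_span b.

Definition metric_tensor := forall x : M, tangent x -> tangent x -> R.

Definition riemannian_metric (U : set M) (g : metric_tensor) : Prop :=
  [/\ forall x, U x -> forall (c : R) (u v w : tangent x),
        g x (c *: u + v) w = c * g x u w + g x v w,
      forall x, U x -> forall u v : tangent x, g x u v = g x v u,
      forall x, U x -> forall v : tangent x, v != 0 -> 0 < g x v v
    & forall X Y, smooth_field U X -> smooth_field U Y ->
        smooth_on U (fun x => g x (X x) (Y x))].

(* The unique vector representing the differential of h (the default 0 is used
   only where g is degenerate). *)
Definition gradient (g : metric_tensor) (h : M -> R) : vector_field := fun x =>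
  xget 0 [set v : tangent x | forall w : tangent x, g x v w = w h].

Definition orth_proj (g : metric_tensor) (E : tangent_distribution) (x : M)
    (v : tangent x) : tangent x :=
  xget 0 [set w : tangent x | E x w /\ forall u, E x u -> g x (v - w) u = 0].

Definition dist_gradient (g : metric_tensor) (E : tangent_distribution)
    (h : M -> R) : vector_field :=
  fun x => orth_proj g E (gradient g h x).

Definition affine_connection (U : set M)
    (nabla : vector_field -> vector_field -> vector_field) : Prop :=
  [/\ forall X Y, smooth_field U X -> smooth_field U Y ->
        smooth_field U (nabla X Y),
      forall a X X' Y, smooth_on U a -> smooth_field U X ->
        smooth_field U X' -> smooth_field U Y ->
        forall x, U x -> nabla (fun y => a y *: X y + X' y) Y x =
                         a x *: nabla X Y x + nabla X' Y x,
      forall X Y Y', smooth_field U X -> smooth_field U Y ->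
        smooth_field U Y' ->
        forall x, U x -> nabla X (fun y => Y y + Y' y) x =
                         nabla X Y x + nabla X Y' x
    & forall a X Y, smooth_on U a -> smooth_field U X -> smooth_field U Y ->
        forall x, U x -> nabla X (fun y => a y *: Y y) x =
                         X x a *: Y x + a x *: nabla X Y x].

Definition levi_civita (U : set M) (g : metric_tensor)
    (nabla : vector_field -> vector_field -> vector_field) : Prop :=
  [/\ affine_connection U nabla,
      forall X Y Z, smooth_field U X -> smooth_field U Y ->
        smooth_field U Z -> forall x, U x ->
        X x (fun y => g y (Y y) (Z y)) =
        g x (nabla X Y x) (Z x) + g x (Y x) (nabla X Z x)
    & forall X Y, smooth_field U X -> smooth_field U Y ->
        forall x, U x -> nabla X Y x - nabla Y X x = lie_bracket X Y x].

Definition hessian (g : metric_tensor)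
    (nabla : vector_field -> vector_field -> vector_field) (h : M -> R)
    (X Y : vector_field) (x : M) : R :=
  g x (nabla X (gradient g h) x) (Y x).

Definition intrinsic_jacobian (N : nat) (g : metric_tensor)
    (nabla : vector_field -> vector_field -> vector_field)
    (E : 'I_N -> tangent_distribution) (J : 'I_N -> M -> R)
    (X : vector_field) : vector_field :=
  nabla X (fun x => \sum_(i < N) dist_gradient g (E i) (J i) x).

End TangentSpace.

Arguments vector_field {R n} M.
Arguments tangent_distribution {R n} M.
Arguments metric_tensor {R n} M.

Section Submanifolds.
Context {R : realType} {k n : nat} {L : manifold R k} {M : manifold R n}.
Context (iota : L -> M).

(* the differential of iota at y *)
Definition pushforward (y : L) (v : tangent y) : tangent (iota y) :=
  derivation_vector (iota y) (fun h => v (h \o iota)).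

Definition injective_immersion : Prop :=
  [/\ smooth_map iota, injective iota & forall y, injective (@pushforward y)].

Definition induced_metric (g : metric_tensor M) : metric_tensor L :=
  fun y v w => g (iota y) (pushforward v) (pushforward w).

(* For an immersion iota, the restriction to L of a field X on M that is
   tangent to L: the unique field on L that is iota-related to X. *)
Definition restrict_field (X : vector_field M) : vector_field L :=
  fun y => xget 0 [set v : tangent y | pushforward v = X (iota y)].

(* Immersed submanifolds of U are given by injective immersions into U. *)
Definition connected_integral_manifold (U : set M)
    (E : tangent_distribution M) : Prop :=
  [/\ injective_immersion, range iota `<=` U, connected [set: L]
    & forall y, range (@pushforward y) = E (iota y)].

End Submanifolds.

(* The leaf through x: the maximal connected integral manifold of E in U whose
   image contains x. *)
Definition is_leaf (R : realType) (k n : nat) (M : manifold R n) (U : set M)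
    (E : tangent_distribution M) (x : M) (L : manifold R k) (iota : L -> M)
    : Prop :=
  [/\ connected_integral_manifold iota U E, range iota x
    & forall k' (L' : manifold R k') (iota' : L' -> M),
        connected_integral_manifold iota' U E ->
        range iota `<=` range iota' -> range iota' `<=` range iota].

(* Main.v *)
From HB Require Import structures.
Require Import Defs.
From mathcomp Require Import all_boot all_order all_algebra.
From mathcomp Require Import all_classical all_reals all_analysis.
From mathcomp Require Import ring lra.
Import Order.TTheory GRing.Theory Num.Theory numFieldNormedType.Exports.

(** Both sides are second derivatives of J_i along the frame, taken in opposite
    orders.  Since the f_{j,r} form a g-orthonormal frame on U, the field that
    the intrinsic Jacobian differentiates is the sum over all j and r of
    a_{j,r} f_{j,r}, where a_{j,r} = f_{j,r}(J_j) (`dist_gradient_frame`).  All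
    the a_{j,r} vanish at the critical point, so the Leibniz rule leaves
    nabla_X (sum a_{j,r} f_{j,r}) = sum X(a_{j,r}) f_{j,r} there, whatever the
    connection is (`connection_critical`).  The (p,q) entry of the i-th diagonal
    block is therefore f_{i,q}(f_{i,p}(J_i)).

    On the leaf, the restrictions F_r of the f_{i,r} form an orthonormal frame
    for the induced metric, and the gradient of the restriction of J_i is
    sum_r F_r(J_i) F_r.  The same computation gives f_{i,p}(f_{i,q}(J_i)) for
    the Hessian.  The difference of the two values is [f_{i,p}, f_{i,q}](J_i) up
    to sign; by involutivity it is a combination of the a_{i,r}, which vanish at
    the critical point.

    The axioms of a connection speak of smooth fields only, so this needs the
    F_r to be smooth on the leaf (`restrict_field_smooth`), and that is where
    the analysis lies.  In charts, the components of F_r solve a linear system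
    whose matrix is the Jacobian matrix of the immersion and whose right-hand
    side is smooth, and Cramer's rule then shows that they are smooth.  Setting
    up that system requires that a derivation of germs is a combination of
    partial derivatives (`tangent_chart`), which rests on Hadamard's lemma
    (`hadamard`): a smooth h can be written
    h(p) + sum_s (u_s - p_s) q_s(u) near p with smooth q_s, namely
    q_s(u) = int_0^1 (d_s h)(p + t (u - p)) dt. *)

Set Implicit Arguments.
Unset Strict Implicit.
Unset Printing Implicit Defensive.
Local Open Scope classical_set_scope.
Local Open Scope ring_scope.

(* The differential of a map; the same short name also denotes the image of a
   measure. *)
Local Notation pushforward := Defs.pushforward.

(** * Functions of class C^k *)

Section FrechetCriterion.
Context {R : realType} {V W : normedModType R}.

Lemma differentiable_expansion (f : V -> W) (x : V) :
  differentiable f x -> forall e : R, 0 < e ->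
  \forall v \near 0, `|f (v + x) - f x - 'd f x v| <= e * `|v|.
Proof.
move=> /diff_locally fx e e0.
have /eqaddoP/(_ _ e0) := fx.
apply: filterS => v /=.
by rewrite !fctE /= opprD addrA.
Qed.

(** Yields differentiability together with the value of the differential, for
    maps whose differential is known only as a candidate [df]. *)
Lemma expansion_differentiable (f : V -> W) (x : V) (df : {linear V -> W}) :
  continuous df ->
  (forall e : R, 0 < e ->
     \forall v \near 0, `|f (v + x) - f x - df v| <= e * `|v|) ->
  differentiable f x /\ 'd f x = df :> (V -> W).
Proof.
move=> cdf fx.
have fE : f \o shift x = cst (f x) + df +o_ 0 id.
  apply/eqaddoP => e e0; apply: filterS (fx _ e0) => v /=.
  by rewrite !fctE /= opprD addrA.
have dE := diff_unique cdf fE.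
split=> //; apply/diff_locallyP; rewrite dE; split => //.
Qed.

Lemma near_eq_differentiable (f g : V -> W) (x : V) :
  (\forall y \near x, f y = g y) -> differentiable f x -> differentiable g x.
Proof.
move=> fg df.
have [] // := @expansion_differentiable g x ('d f x) (diff_continuous df).
move=> e e0; have := differentiable_expansion df e0.
have fg0 : \forall v \near 0, f (v + x) = g (v + x).
  by move: fg; rewrite (near_shift 0)/= subr0; apply: filterS.
apply: filterS2 fg0 => v <-.
by rewrite (nbhs_singleton fg).
Qed.

End FrechetCriterion.

Section CkBasics.
Context {R : realType} {V W : normedModType R}.
Implicit Types (A B : set V) (f g : V -> W).

Lemma Ck_continuous k A f x : Ck k A f -> A x -> {for x, continuous f}.
Proof.
case: k => [|k] /=; first exact.
by move=> [df _] Ax; apply: differentiable_continuous; exact: df.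
Qed.

Lemma Ck_derive k A f v : Ck k.+1 A f -> Ck k A ('D_v f).
Proof. by case=> _; exact. Qed.

Lemma CkS k A f : Ck k.+1 A f -> Ck k A f.
Proof.
elim: k f => [|k IH] f [df Df];
  first by move=> x /df /differentiable_continuous.
by split=> // v; apply: IH; exact: Df.
Qed.

Lemma Ck_sub k A B f : B `<=` A -> Ck k A f -> Ck k B f.
Proof.
move=> BA; elim: k f => [|k IH] f /=; first by move=> cf x /BA; exact: cf.
by move=> [df Df]; split=> [x /BA|v]; [exact: df|exact: IH].
Qed.

(** Openness of [A] makes equality on [A] an equality of germs, so that all
    derivatives agree as well. *)
Lemma Ck_ext k A f g : open A -> {in A, f =1 g} -> Ck k A f -> Ck k A g.
Proof.
move=> oA.
have near_fg (h h' : V -> W) x : {in A, h =1 h'} -> A x ->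
    \forall y \near x, h y = h' y.
  move=> hh Ax; apply: (@filterS _ _ _ A) (open_nbhs_nbhs (conj oA Ax)).
  by move=> y Ay; apply: hh; rewrite inE.
elim: k f g => [|k IH] f g fg /=.
  move=> cf x Ax; have nfg := near_fg _ _ _ fg Ax.
  change (g @ x --> g x); rewrite -(nbhs_singleton nfg).
  by apply: cvg_trans (cf x Ax); exact: near_eq_cvg nfg.
move=> [df Df]; split=> [x Ax|v].
  exact: near_eq_differentiable (near_fg _ _ _ fg Ax) (df _ Ax).
apply: IH (Df v) => x; rewrite inE => Ax.
exact: near_eq_derive (near_fg _ _ _ fg Ax).
Qed.

Lemma Ck_cst k A (c : W) : Ck k A (fun=> c).
Proof.
elim: k c => [|k IH] c /=; first by move=> x _; exact: cst_continuous.
split=> [x _|v]; first exact: differentiable_cst.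
rewrite [X in Ck _ _ X](_ : _ = fun=> 0) //; apply/funext => x.
by have := derive_cst c x v.
Qed.

Lemma CkD k A f g : open A -> Ck k A f -> Ck k A g ->
  Ck k A (fun x => f x + g x).
Proof.
move=> oA; elim: k f g => [|k IH] f g /=.
  by move=> cf cg x Ax; apply: continuousD; [exact: cf|exact: cg].
move=> [df Df] [dg Dg]; split=> [x Ax|v].
  by apply: differentiableD; [exact: df|exact: dg].
apply: Ck_ext (IH _ _ (Df v) (Dg v)) => // x; rewrite inE => Ax.
rewrite -[LHS]deriveD //; apply: diff_derivable; [exact: df|exact: dg].
Qed.

(** The chain rule in this form reduces the class of a composite, by induction
    on the order, to the classes of sums and products. *)
Lemma derive_comp_partial (m : nat) (f : V -> 'rV[R]_m) (g : 'rV[R]_m -> R)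
    (x v : V) : differentiable f x -> differentiable g (f x) ->
  'D_v (g \o f) x =
  \sum_(s < m) 'D_(delta_mx 0 s) g (f x) * ('D_v f x) 0 s.
Proof.
move=> df dg.
rewrite deriveE; last exact: differentiable_comp.
rewrite diff_comp //= -(deriveE _ df).
rewrite [in LHS](row_sum_delta ('D_v f x)) linear_sum.
by apply: eq_bigr => s _; rewrite linearZ /= -deriveE // mulrC.
Qed.

End CkBasics.

Lemma derive_partial {R : realType} (m : nat) (g : 'rV[R]_m -> R) x v :
  differentiable g x ->
  'D_v g x = \sum_(s < m) v 0 s * 'D_(delta_mx 0 s) g x.
Proof.
move=> dg; rewrite deriveE // [in LHS](row_sum_delta v) linear_sum.
by apply: eq_bigr => s _; rewrite linearZ /= -deriveE.
Qed.

Section CkScalar.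
Context {R : realType} {V : normedModType R}.
Implicit Types (A : set V) (f g : V -> R).

Lemma CkM k A f g : open A -> Ck k A f -> Ck k A g ->
  Ck k A (fun x => f x * g x).
Proof.
move=> oA; elim: k f g => [|k IH] f g.
  by move=> cf cg x Ax; apply: continuousM; [exact: cf|exact: cg].
move=> kf kg; have [df Df] := kf; have [dg Dg] := kg; split=> [x Ax|v].
  by apply: differentiableM; [exact: df|exact: dg].
have H := CkD oA (IH _ _ (CkS kf) (Dg v)) (IH _ _ (CkS kg) (Df v)).
apply: Ck_ext H => //.
move=> x; rewrite inE => Ax.
rewrite -[LHS]deriveM //; apply: diff_derivable; [exact: df|exact: dg].
Qed.

Lemma Ck_sum k A (I : Type) (r : seq I) (F : I -> V -> R) : open A ->
  (forall i, Ck k A (F i)) -> Ck k A (fun x => \sum_(i <- r) F i x).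
Proof.
move=> oA FA; elim: r => [|i r IH].
  under eq_fun do rewrite big_nil; exact: Ck_cst.
by under eq_fun do rewrite big_cons; exact: CkD.
Qed.

Lemma CkV k A f : open A -> (forall x, A x -> f x != 0) -> Ck k A f ->
  Ck k A (fun x => (f x)^-1).
Proof.
move=> oA f0; elim: k => [|k IH].
  by move=> cf x Ax; apply: continuousV; [exact: f0|exact: cf].
move=> kf; have [df Df] := kf; split=> [x Ax|v].
  by apply: differentiableV; [exact: df|exact: f0].
have kV := IH (CkS kf).
have kN : Ck k A (fun=> -1 : R) by exact: Ck_cst.
have H := CkM oA kN (CkM oA (CkM oA kV kV) (Df v)).
apply: Ck_ext H => //.
move=> x; rewrite inE => Ax /=.
rewrite [RHS]deriveV; [|exact: f0|exact/diff_derivable/df].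
by rewrite mulN1r scaleNr -exprVn expr2.
Qed.

Lemma Ck_coord k A (m : nat) (f : V -> 'rV[R]_m) s : open A -> Ck k A f ->
  Ck k A (fun x => f x 0 s).
Proof.
move=> oA; elim: k f => [|k IH] f.
  move=> cf x Ax; apply: (@continuous_comp _ _ _ f (fun M : 'rV[R]_m => M 0 s)).
    exact: cf.
  exact: coord_continuous.
move=> [df Df]; split=> [x Ax|v].
  apply: (@differentiable_comp _ _ _ _ f (fun M : 'rV[R]_m => M 0 s)).
    exact: df.
  exact: differentiable_coord.
apply: Ck_ext (IH _ (Df v)) => // x; rewrite inE => Ax.
by rewrite derive_mx ?mxE //; apply/diff_derivable/df.
Qed.

Lemma Ck_comp k A (m : nat) (B : set 'rV[R]_m) (f : V -> 'rV[R]_m)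
    (g : 'rV[R]_m -> R) : open A -> (forall x, A x -> B (f x)) ->
  Ck k A f -> Ck k B g -> Ck k A (g \o f).
Proof.
move=> oA AB; elim: k g => [|k IH] g.
  by move=> cf cg x Ax; apply: continuous_comp; [exact: cf|exact/cg/AB].
move=> kf [dg Dg]; have [df Df] := kf; split=> [x Ax|v].
  by apply: differentiable_comp; [exact: df|exact/dg/AB].
apply: Ck_ext (@Ck_sum k A _ (index_enum 'I_m) (fun s x =>
  ('D_(delta_mx 0 s) g \o f) x * ('D_v f x) 0 s) oA _) => //.
  move=> x; rewrite inE => Ax.
  by rewrite derive_comp_partial //; [exact: df|exact/dg/AB].
move=> s; apply: CkM => //; last by apply: Ck_coord => //; exact: Df.
by apply: IH; [exact: CkS|exact: Dg].
Qed.

End CkScalar.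

Lemma derive_rV_coord {R : realType} (m : nat) (x v : 'rV[R]_m) s :
  'D_v (fun u : 'rV[R]_m => u 0 s) x = v 0 s.
Proof.
have dv : derivable (@id 'rV[R]_m) x v by exact: derivable_id.
by have /matrixP/(_ 0 s) := derive_mx dv; rewrite derive_id mxE => ->.
Qed.

Lemma Ck_rV_coord {R : realType} (m : nat) k (A : set 'rV[R]_m) s :
  Ck k A (fun u : 'rV[R]_m => u 0 s).
Proof.
case: k => [|k]; first by move=> x _; exact: coord_continuous.
split=> [x _|v]; first exact: differentiable_coord.
under eq_fun do rewrite derive_rV_coord; exact: Ck_cst.
Qed.

(** * Integrals over the unit interval *)

Section UnitIntegral.
Context {R : realType}.
Implicit Types f g : R -> R.

Definition int01 f : R := \int[@lebesgue_measure R]_(t in `[0, 1]) f t.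

Definition cont01 f := forall t : R, 0 <= t <= 1 -> {for t, continuous f}.

Lemma cont01_within f : cont01 f -> {within `[0, 1], continuous f}.
Proof.
move=> cf; apply: continuous_in_subspaceT => t; rewrite inE /= in_itv /=.
exact: cf.
Qed.

Lemma cont01_integrable f : cont01 f ->
  (@lebesgue_measure R).-integrable `[0, 1] (EFin \o f).
Proof.
move=> /cont01_within cf.
by apply: continuous_compact_integrable => //; exact: segment_compact.
Qed.

Lemma cont01D f g : cont01 f -> cont01 g -> cont01 (fun t => f t + g t).
Proof. by move=> cf cg t t01; apply: continuousD; [exact: cf|exact: cg]. Qed.

Lemma cont01M f g : cont01 f -> cont01 g -> cont01 (fun t => f t * g t).
Proof. by move=> cf cg t t01; apply: continuousM; [exact: cf|exact: cg]. Qed.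

Lemma cont01_cst (c : R) : cont01 (fun=> c).
Proof. by move=> t _; exact: cst_continuous. Qed.

Lemma eq_int01 f g :
  (forall t : R, 0 <= t <= 1 -> f t = g t) -> int01 f = int01 g.
Proof.
by move=> fg; apply: eq_Rintegral => t; rewrite inE /= in_itv /= => /fg.
Qed.

Lemma int01D f g : cont01 f -> cont01 g ->
  int01 (fun t => f t + g t) = int01 f + int01 g.
Proof. by move=> cf cg; apply: RintegralD => //; exact: cont01_integrable. Qed.

Lemma int01Z (c : R) f : cont01 f -> int01 (fun t => c * f t) = c * int01 f.
Proof. by move=> cf; apply: RintegralZl => //; exact: cont01_integrable. Qed.

Lemma int01_cst (c : R) : int01 (fun=> c) = c.
Proof.
rewrite /int01 Rintegral_cst //= lebesgue_measure_itv /= lte_fin ltr01.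
by rewrite -EFinD /= subr0 mulr1.
Qed.

Lemma cont01_sum (I : Type) (s : seq I) (F : I -> R -> R) :
  (forall i, cont01 (F i)) -> cont01 (fun t => \sum_(i <- s) F i t).
Proof.
move=> cF; elim: s => [|i s IH].
  by under eq_fun do rewrite big_nil; exact: cont01_cst.
by under eq_fun do rewrite big_cons; exact: cont01D.
Qed.

Lemma int01_sum (I : Type) (s : seq I) (F : I -> R -> R) :
  (forall i, cont01 (F i)) ->
  int01 (fun t => \sum_(i <- s) F i t) = \sum_(i <- s) int01 (F i).
Proof.
move=> cF; elim: s => [|i s IH].
  by under [in LHS]eq_fun do rewrite big_nil; rewrite int01_cst big_nil.
under [in LHS]eq_fun do rewrite big_cons.
by rewrite big_cons int01D ?IH //; exact: cont01_sum.
Qed.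

Lemma int01_le_norm f (c : R) : cont01 f ->
  (forall t : R, 0 <= t <= 1 -> `|f t| <= c) -> `|int01 f| <= c.
Proof.
move=> cf fc; rewrite -[leRHS]int01_cst.
apply: le_trans (le_normr_Rintegral _ (cont01_integrable cf)) _ => //.
apply: le_Rintegral => //.
- apply: (@cont01_integrable (fun t => `|f t|)) => t t01.
  apply: (@continuous_comp _ _ _ f (fun x : R => `|x|)); first exact: cf.
  exact: norm_continuous.
- by apply: (@cont01_integrable (fun=> c)); exact: cont01_cst.
Qed.

Lemma int01_derive f f' : cont01 f' ->
  (forall t : R, 0 <= t <= 1 -> is_derive t 1 f (f' t)) ->
  int01 f' = f 1 - f 0.
Proof.
move=> cf' df.
have cf : cont01 f.
  by move=> t /df dft; apply/differentiable_continuous/derivable1_diffP.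
rewrite /int01 /Rintegral (@continuous_FTC2 _ _ f) //.
- exact: cont01_within.
- have /(continuous_within_itvP _ ltr01)[] := cont01_within cf.
  move=> _ f0 f1; split => // t; rewrite in_itv /= => /andP[t0 t1].
  by have [] := df t; rewrite ?(ltW t0) ?(ltW t1).
- move=> t; rewrite in_itv /= => /andP[t0 t1].
  by rewrite derive1E; have [] := df t; rewrite ?(ltW t0) ?(ltW t1).
Qed.

End UnitIntegral.

(** * Taylor remainders *)

Section Segments.
Context {R : realType} {V : normedModType R}.
Implicit Types (g : V -> R) (a w : V).

(** The difference quotients on both sides are the same function of the
    increment, so derivability in the direction [w] is enough. *)
Lemma is_derive_line g a w (t : R) : derivable g (a + t *: w) w ->
  is_derive t 1 (fun s => g (a + s *: w)) ('D_w g (a + t *: w)).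
Proof.
have E : (fun h : R => h^-1 *: (((fun s => g (a + s *: w)) \o shift t) (h *: 1)
              - g (a + t *: w)))
       = (fun h : R => h^-1 *: ((g \o shift (a + t *: w)) (h *: w)
              - g (a + t *: w))).
  apply/funext => h /=; congr (_ *: (g _ - _)).
  by rewrite [h *: 1]mulr1 scalerDl addrCA.
move=> dg; split.
- by rewrite /derivable /= E.
- by rewrite /derive /= E.
Qed.

Lemma MVT_line g a w :
  (forall t : R, 0 <= t <= 1 -> differentiable g (a + t *: w)) ->
  exists2 c, 0 <= c <= 1 & g (a + w) - g a = 'D_w g (a + c *: w).
Proof.
move=> dg.
have D (t : R) : 0 <= t <= 1 ->
    is_derive t 1 (fun s => g (a + s *: w)) ('D_w g (a + t *: w)).
  by move=> t01; exact/is_derive_line/diff_derivable/dg.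
have [||c c01 E] := @MVT _ (fun s => g (a + s *: w))
    (fun t => 'D_w g (a + t *: w)) 0 1 ltr01.
- move=> t; rewrite in_itv /= => /andP[t0 t1].
  by apply: D; rewrite !ltW.
- apply: cont01_within => t /D dt.
  exact/differentiable_continuous/derivable1_diffP.
exists c; first by move: c01; rewrite in_itv /= => /andP[? ?]; rewrite !ltW.
by move: E; rewrite scale1r scale0r addr0 subr0 mulr1.
Qed.

(** The mean value theorem, applied to [g] and then to its derivative along
    [w]. *)
Lemma taylor_line g a w :
  (forall t : R, 0 <= t <= 1 -> differentiable g (a + t *: w)) ->
  (forall t : R, 0 <= t <= 1 -> differentiable ('D_w g) (a + t *: w)) ->
  exists2 c, 0 <= c <= 1 &
    `|g (a + w) - g a - 'D_w g a| <= `|'D_w ('D_w g) (a + c *: w)|.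
Proof.
move=> dg ddg; have [c /andP[c0 c1] ->] := MVT_line dg.
have [|e /andP[e0 e1]] := @MVT_line ('D_w g) a (c *: w).
  move=> t /andP[t0 t1]; rewrite scalerA; apply: ddg.
  by rewrite mulr_ge0 //= mulr_ile1.
have ec01 : 0 <= e * c <= 1 by rewrite mulr_ge0 //= mulr_ile1.
rewrite scalerA => E; exists (e * c) => //.
rewrite E deriveE; last exact: ddg.
rewrite linearZ /= -deriveE; last exact: ddg.
by rewrite normrM ger0_norm // ler_piMl.
Qed.

End Segments.

Lemma rV_coord_le {R : realType} (n : nat) (w : 'rV[R]_n) s : `|w 0 s| <= `|w|.
Proof.
rewrite [leRHS]/Num.Def.normr /= mx_normrE.
by apply/bigmax_geP; right; exists (0, s).
Qed.

Lemma compact_bound {R : realType} (T : topologicalType) (K : set T)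
    (f : T -> R) :
  compact K -> (forall x, K x -> {for x, continuous f}) ->
  exists2 C : R, 0 <= C & forall x, K x -> `|f x| <= C.
Proof.
move=> cK cf; have fK : {within K, continuous f}.
  by apply: continuous_in_subspaceT => x; rewrite inE; exact: cf.
have [M [_ hM]] := compact_bounded (continuous_compact fK cK).
exists (`|M| + 1) => [|x Kx]; first by rewrite addr_ge0.
by apply: (hM (`|M| + 1)); [rewrite ltr_pwDr // ler_norm|exists x].
Qed.

Section SecondDerivative.
Context {R : realType} {n : nat}.
Local Notation e s := (delta_mx 0 s : 'rV[R]_n).

(** The second derivative along [w] is a quadratic form in the components of [w]
    whose coefficients are continuous, hence bounded on a compact set. *)
Lemma second_derivative_bound (A K : set 'rV[R]_n) (h : 'rV[R]_n -> R) :
  open A -> Ck 2 A h -> compact K -> K `<=` A ->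
  exists2 C : R, 0 <= C &
    forall x w, K x -> `|'D_w ('D_w h) x| <= C * `|w| ^+ 2.
Proof.
move=> oA [dh Dh] cK KA.
have b s t : exists C : R, 0 <= C /\
    forall x, K x -> `|'D_(e t) ('D_(e s) h) x| <= C.
  have [_ /(_ (e t)) /= cst] := Dh (e s).
  have [|C C0 hC] := @compact_bound R _ K ('D_(e t) ('D_(e s) h)) cK.
    by move=> x /KA; exact: cst.
  by exists C.
have [C hC] := choice (fun st : 'I_n * 'I_n => b st.1 st.2).
exists (\sum_s \sum_t C (s, t)).
  by apply: sumr_ge0 => s _; apply: sumr_ge0 => t _; have [] := hC (s, t).
move=> x w Kx; have Ax := KA _ Kx.
have -> : 'D_w ('D_w h) x =
    \sum_s \sum_t (w 0 s * w 0 t) * 'D_(e t) ('D_(e s) h) x.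
  rewrite (@near_eq_derive _ _ _ _
    (\sum_(s < n) (fun y => w 0 s *: 'D_(e s) h y))); last first.
    apply: (@filterS _ _ _ A) (open_nbhs_nbhs (conj oA Ax)) => y Ay.
    by rewrite derive_partial ?fct_sumE //; exact: dh.
  have dD s : differentiable ('D_(e s) h) x by have [/(_ _ Ax)] := Dh (e s).
  rewrite derive_sum; last by move=> s; apply/derivableZ/diff_derivable.
  apply: eq_bigr => s _; rewrite -[LHS]/('D_w (w 0 s *: 'D_(e s) h) x).
  rewrite deriveZ; last exact: diff_derivable.
  rewrite derive_partial // scaler_sumr; apply: eq_bigr => t _.
  by rewrite [LHS]mulrA.
rewrite mulr_suml; apply: le_trans (ler_norm_sum _ _ _) _.
apply: ler_sum => s _; rewrite mulr_suml.
apply: le_trans (ler_norm_sum _ _ _) _; apply: ler_sum => t _.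
have [C0 /(_ _ Kx) hx] := hC (s, t).
rewrite normrM mulrC; apply: ler_pM => //.
by rewrite normrM expr2; apply: ler_pM => //; exact: rV_coord_le.
Qed.

End SecondDerivative.

(** * Hadamard's lemma *)

Section RadialMean.
Context {R : realType} {n : nat}.
Variables (p : 'rV[R]_n) (r : R).
Implicit Types (h : 'rV[R]_n -> R) (u v : 'rV[R]_n).
Local Notation e s := (delta_mx 0 s : 'rV[R]_n).
Local Notation B := (ball p r).
Local Notation pt u t := (p + t *: (u - p)).

(** Differentiating under the integral sign brings out a factor [t]; with the
    weight [t ^+ m] the family of all these means is closed under
    differentiation. *)
Definition radial_mean m h u : R := int01 (fun t => t ^+ m * h (pt u t)).

Lemma ball_contract u (t : R) : B u -> 0 <= t <= 1 -> B (pt u t).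
Proof.
rewrite -ball_normE /= => Bu /andP[t0 t1].
rewrite opprD addNKr normrN normrZ ger0_norm // distrC.
by apply: le_lt_trans Bu; rewrite ler_piMl.
Qed.

Lemma radial_cont01 m h u : (forall x, B x -> {for x, continuous h}) -> B u ->
  cont01 (fun t => t ^+ m * h (pt u t)).
Proof.
move=> ch Bu; apply: cont01M => t t01; first exact: exprn_continuous.
apply: (@continuous_comp _ _ _ (fun t : R => pt u t) h).
  apply: continuousD; first exact: cst_continuous.
  exact: scalel_continuous.
exact/ch/ball_contract.
Qed.

Lemma radial_mean_derive m h u v : Ck 1 B h -> B u ->
  radial_mean m ('D_v h) u =
  \sum_s v 0 s * radial_mean m ('D_(e s) h) u.
Proof.
move=> h1 Bu; have [dh _] := h1.
have c s : cont01 (fun t => t ^+ m * 'D_(e s) h (pt u t)).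
  apply: (radial_cont01 (h := 'D_(e s) h)) => // x.
  exact: (Ck_continuous (Ck_derive _ h1)).
under eq_bigr do rewrite /radial_mean -int01Z //.
rewrite -int01_sum; last by move=> s; apply: cont01M => //; exact: cont01_cst.
apply: eq_int01 => t t01.
rewrite derive_partial; last exact/dh/ball_contract.
by rewrite mulr_sumr; apply: eq_bigr => s _; rewrite mulrCA.
Qed.

(** The integrand at [v + u] differs from its first-order expansion in [v] by at
    most [C * |v| ^ 2], uniformly in [t], because second derivatives of [h] are
    bounded on a compact ball that contains all the segments involved. *)
Lemma radial_mean_differentiable m h u : Ck 2 B h -> B u ->
  differentiable (radial_mean m h) u /\
  forall v, 'D_v (radial_mean m h) u = radial_mean m.+1 ('D_v h) u.
Proof.
move=> h2 Bu; have h1 := CkS h2; have [dh Dh] := h2.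
have ch x : B x -> {for x, continuous h} by exact: (Ck_continuous h2).
have cDh v x : B x -> {for x, continuous ('D_v h)}.
  exact: (Ck_continuous (Ck_derive v h2)).
pose c s := radial_mean m.+1 ('D_(e s) h) u.
pose df v : R := \sum_s v 0 s * c s.
have ldf : linear df.
  move=> a v w; rewrite /df scaler_sumr -big_split; apply: eq_bigr => s _ /=.
  by rewrite !mxE mulrDl [_ *: _]mulrA.
pose Ldf : {linear 'rV[R]_n -> R} :=
  HB.pack df (GRing.isLinear.Build _ _ _ _ _ ldf).
have dfE v : df v = radial_mean m.+1 ('D_v h) u by rewrite radial_mean_derive.
have cdf : continuous df.
  move=> v; apply: (@Ck_continuous _ _ _ 0 setT) => //.
  apply: Ck_sum => [|s]; first exact: openT.
  apply: CkM; [exact: openT|exact: Ck_rV_coord|exact: Ck_cst].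
suff [d E] : differentiable (radial_mean m h) u /\
    'd (radial_mean m h) u = Ldf :> ('rV[R]_n -> R).
  by split=> // v; rewrite deriveE // E -dfE.
apply: expansion_differentiable => // eps eps0.
move: (Bu); rewrite -ball_normE /= => ur.
(* A compact ball K around p that has u in its interior and lies in B. *)
pose rho := (`|p - u| + r) / 2.
have [urho rhor] : `|p - u| < rho /\ rho < r by rewrite /rho; split; lra.
pose K := [set x : 'rV[R]_n | `|p - x| <= rho].
have KB : K `<=` B.
  by move=> x; rewrite -ball_normE /= => /le_lt_trans; exact.
have cK : compact K.
  apply: bounded_closed_compact; last exact: closed_closed_ball_.
  exists (`|p| + rho); split=> [|M /ltW hM x /= Kx]; first exact: num_real.
  apply: le_trans hM; rewrite -[x in `|x|](subKr p).
  by apply: le_trans (ler_normB _ _) _; rewrite lerD2l.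
have [C C0 hC] := second_derivative_bound (ball_open _ _) h2 cK KB.
(* The first bound on v keeps u + v in K, the second one turns C * |v| ^ 2 into
   at most eps * |v|; C itself may be 0, whence C + 1. *)
have d0 : 0 < Num.min (rho - `|p - u|) (eps / (C + 1)).
  by rewrite lt_min subr_gt0 urho divr_gt0 // ltr_wpDl.
apply: filterS (nbhs0_lt d0) => v; rewrite lt_min => /andP[v1 v2].
have Kuv (tau : R) : 0 <= tau <= 1 -> K (u + tau *: v).
  move=> /andP[t0 t1]; rewrite /K /= opprD addrA.
  apply: le_trans (ler_normB _ _) _; rewrite normrZ ger0_norm //.
  rewrite -lerBrDl; apply: le_trans (ltW v1).
  by rewrite ler_piMl.
have Buv : B (v + u).
  by apply: KB; rewrite addrC -[v]scale1r; apply: Kuv; rewrite ler01 lexx.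
have cG : cont01 (fun t => t ^+ m * h (pt u t)) by exact: radial_cont01.
have cGv : cont01 (fun t => t ^+ m * h (pt (v + u) t)) by exact: radial_cont01.
have cD : cont01 (fun t => t ^+ m.+1 * 'D_v h (pt u t)).
  by apply: (radial_cont01 (h := 'D_v h)) => // x; exact: cDh.
have cN (f : R -> R) : cont01 f -> cont01 (fun t => -1 * f t).
  by move=> cf; apply: cont01M => //; exact: cont01_cst.
have [cNG cND] := (cN _ cG, cN _ cD); have cGG := cont01D cGv cNG.
have -> : radial_mean m h (v + u) - radial_mean m h u - df v =
    int01 (fun t => t ^+ m * h (pt (v + u) t) + -1 * (t ^+ m * h (pt u t)) +
      -1 * (t ^+ m.+1 * 'D_v h (pt u t))).
  by rewrite dfE !int01D // !int01Z // !mulN1r.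
apply: (@le_trans _ _ (C * `|v| ^+ 2)).
  apply: int01_le_norm; first exact: cont01D.
  move=> t t01; have /andP[t0 t1] := t01.
  have lineE (s : R) : pt u t + s *: (t *: v) = p + t *: (u + s *: v - p).
    by rewrite -addrA [u + _ - p]addrAC [in RHS](scalerDr t (u - p)) !scalerA
      (mulrC s).
  have Kline (s : R) : 0 <= s <= 1 -> K (pt u t + s *: (t *: v)).
    move=> s01; rewrite lineE /K /= opprD addNKr normrN normrZ ger0_norm //.
    rewrite distrC; apply: le_trans (Kuv _ s01).
    by rewrite ler_piMl.
  have [s s01 ineq] : exists2 s : R, 0 <= s <= 1 &
     `|h (pt u t + t *: v) - h (pt u t) - 'D_(t *: v) h (pt u t)| <=
     `|'D_(t *: v) ('D_(t *: v) h) (pt u t + s *: (t *: v))|.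
    apply: taylor_line => s s01; first exact/dh/KB/Kline.
    by have [+ _] := Dh (t *: v); apply; exact/KB/Kline.
  have -> : t ^+ m * h (pt (v + u) t) + -1 * (t ^+ m * h (pt u t)) +
      -1 * (t ^+ m.+1 * 'D_v h (pt u t)) = t ^+ m *
      (h (pt u t + t *: v) - h (pt u t) - 'D_(t *: v) h (pt u t)).
    have -> : 'D_(t *: v) h (pt u t) = t * 'D_v h (pt u t).
      have dht : differentiable h (pt u t) by exact/dh/ball_contract.
      by rewrite !deriveE // linearZ.
    have -> : pt (v + u) t = pt u t + t *: v.
      by rewrite -[RHS]addrA -scalerDr [v + u]addrC addrAC.
    by rewrite exprSr; ring.
  rewrite normrM; apply: le_trans (_ : 1 * (C * `|t *: v| ^+ 2) <= _).
    apply: ler_pM => //; first by rewrite normrX ger0_norm // exprn_ile1.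
    by apply: le_trans ineq _; apply/hC/Kline.
  rewrite mul1r ler_wpM2l // ler_sqr ?nnegrE // normrZ ger0_norm //.
  by rewrite ler_piMl.
rewrite expr2 mulrA ler_wpM2r //.
have C1 : 0 < C + 1 by rewrite ltr_wpDl.
move: v2; rewrite ltr_pdivlMr // => /ltW; apply: le_trans.
by rewrite mulrC ler_wpM2l // lerDl.
Qed.

Lemma radial_mean_Ck k m h : Cinfty B h -> Ck k B (radial_mean m h).
Proof.
elim: k m h => [|k IH] m h Bh.
  move=> x Bx; apply: differentiable_continuous.
  by have [] := radial_mean_differentiable m (Bh 2%N) Bx.
split=> [x Bx|v]; first by have [] := radial_mean_differentiable m (Bh 2%N) Bx.
apply: (@Ck_ext _ _ _ _ _ (radial_mean m.+1 ('D_v h))).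
- exact: ball_open.
- move=> x; rewrite inE => Bx.
  by have [_ ->] := radial_mean_differentiable m (Bh 2%N) Bx.
- by apply: IH => k'; have [_] := Bh k'.+1; exact.
Qed.

(** The fundamental theorem of calculus along the segment from [p] to [u]. *)
Lemma hadamard_ball h u : Ck 1 B h -> B u ->
  h u = h p + \sum_s (u - p) 0 s * radial_mean 0 ('D_(e s) h) u.
Proof.
move=> h1 Bu; have [dh _] := h1.
rewrite -radial_mean_derive // /radial_mean.
have cD : cont01 (fun t => t ^+ 0 * 'D_(u - p) h (pt u t)).
  apply: (radial_cont01 (h := 'D_(u - p) h)) => // x.
  exact: (Ck_continuous (Ck_derive _ h1)).
have dh_line (t : R) : 0 <= t <= 1 ->
    is_derive t 1 (fun t => h (pt u t)) (t ^+ 0 * 'D_(u - p) h (pt u t)).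
  move=> t01; rewrite expr0 mul1r.
  by apply/is_derive_line/diff_derivable/dh/ball_contract.
rewrite (int01_derive cD dh_line).
by rewrite scale0r addr0 scale1r [p + (_ - _)]addrC subrK [RHS]addrC subrK.
Qed.

End RadialMean.

(** Hadamard's lemma.  The quotients [q s] are again smooth, which is what
    allows a derivation to be applied to them. *)
Lemma hadamard {R : realType} {n : nat} (p : 'rV[R]_n) (h : 'rV[R]_n -> R) :
  Cinfty_near p h -> exists2 q : 'I_n -> 'rV[R]_n -> R,
    (forall s, Cinfty_near p (q s)) &
    \forall u \near p, h u = h p + \sum_s (u 0 s - p 0 s) * q s u.
Proof.
move=> [A [oA Ap] hA].
have /nbhs_ballP[r /= r0 rA] := open_nbhs_nbhs (conj oA Ap).
have hB k : Ck k (ball p r) h by apply: Ck_sub (hA k).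
exists (fun s => radial_mean p 0 ('D_(delta_mx 0 s) h)) => [s|].
  exists (ball p r); first by split; [exact: ball_open|exact: ballxx].
  by move=> k; apply: radial_mean_Ck => k'; have [_] := hB k'.+1; exact.
apply: filterS (nbhsx_ballx p r r0) => u Bu.
rewrite (hadamard_ball (hB 1%N) Bu); congr (_ + _).
by apply: eq_bigr => s _; rewrite !mxE.
Qed.

(** * Smooth functions on a manifold *)

Section CinftyNear.
Context {R : realType} {V W : normedModType R}.
Implicit Types (p : V) (f g : V -> W).

Lemma Cinfty_nearW p (S : set V) f : nbhs p S -> Cinfty S f ->
  Cinfty_near p f.
Proof.
move=> pS Sf; exists S^°; first by split; [exact: open_interior|].
by move=> k; apply: Ck_sub (Sf k); exact: interior_subset.
Qed.

Lemma Cinfty_near_nbhs p f : Cinfty_near p f ->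
  \forall u \near p, Cinfty_near u f.
Proof.
move=> [A [oA Ap] fA]; apply: filterS (open_nbhs_nbhs (conj oA Ap)) => u Au.
by exists A.
Qed.

Lemma Cinfty_near_ext p f g : (\forall u \near p, f u = g u) ->
  Cinfty_near p f -> Cinfty_near p g.
Proof.
move=> fg [A oA fA].
have pS : nbhs p (A `&` [set u | f u = g u]).
  by apply: filterI => //; exact: open_nbhs_nbhs.
exists (A `&` [set u | f u = g u])^°.
  by split; [exact: open_interior|].
move=> k; apply: (Ck_ext (f := f) (open_interior _)).
  by move=> u; rewrite inE => /interior_subset[].
by apply: Ck_sub (fA k) => u /interior_subset[].
Qed.

Lemma Cinfty_near2 p f (g : V -> R) : Cinfty_near p f -> Cinfty_near p g ->
  exists A, [/\ open A, A p, Cinfty A f & Cinfty A g].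
Proof.
move=> [A [oA Ap] fA] [B [oB Bp] gB]; exists (A `&` B); split.
- exact: openI.
- by [].
- by move=> k; apply: Ck_sub (fA k) => u [].
- by move=> k; apply: Ck_sub (gB k) => u [].
Qed.

Lemma Cinfty_near_differentiable p f : Cinfty_near p f -> differentiable f p.
Proof. by move=> [A [_ Ap] /(_ 1%N)[+ _]]; exact. Qed.

Lemma Cinfty_near_continuous p f : Cinfty_near p f -> {for p, continuous f}.
Proof. by move=> /Cinfty_near_differentiable/differentiable_continuous. Qed.

Lemma Cinfty_near_derive p f v : Cinfty_near p f -> Cinfty_near p ('D_v f).
Proof. by move=> [A oA fA]; exists A => // k; exact/Ck_derive/fA. Qed.

End CinftyNear.

Section CinftyNearScalar.
Context {R : realType} {V : normedModType R}.
Implicit Types (p : V) (f g : V -> R).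

Lemma Cinfty_near_cst p (c : R) : Cinfty_near p (fun=> c).
Proof. by exists setT => [|k]; [split=> //; exact: openT|exact: Ck_cst]. Qed.

Lemma Cinfty_nearD p f g : Cinfty_near p f -> Cinfty_near p g ->
  Cinfty_near p (fun u => f u + g u).
Proof.
move=> pf pg; have [A [oA Ap fA gA]] := Cinfty_near2 pf pg.
by exists A => // k; exact: CkD.
Qed.

Lemma Cinfty_nearM p f g : Cinfty_near p f -> Cinfty_near p g ->
  Cinfty_near p (fun u => f u * g u).
Proof.
move=> pf pg; have [A [oA Ap fA gA]] := Cinfty_near2 pf pg.
by exists A => // k; exact: CkM.
Qed.

Lemma Cinfty_nearV p f : f p != 0 -> Cinfty_near p f ->
  Cinfty_near p (fun u => (f u)^-1).
Proof.
move=> fp pf; have cf := Cinfty_near_continuous pf.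
have [A [oA Ap] fA] := pf.
have pS : nbhs p (A `&` [set u | f u != 0]).
  apply: filterI; first exact: open_nbhs_nbhs.
  exact: (cf _ (open_nbhs_nbhs (conj (@open_neq R 0) fp))).
exists (A `&` [set u | f u != 0])^°; first by split; [exact: open_interior|].
move=> k; apply: CkV; first exact: open_interior.
  by move=> u /interior_subset[].
by apply: Ck_sub (fA k) => u /interior_subset[].
Qed.

Lemma Cinfty_near_comp (m : nat) p (f : V -> 'rV[R]_m) (g : 'rV[R]_m -> R) :
  Cinfty_near p f -> Cinfty_near (f p) g -> Cinfty_near p (g \o f).
Proof.
move=> pf [B oB gB]; have cf := Cinfty_near_continuous pf.
have [A oA fA] := pf.
have pS : nbhs p (A `&` [set u | B (f u)]).
  apply: filterI; first exact: open_nbhs_nbhs.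
  exact: (cf _ (open_nbhs_nbhs oB)).
exists (A `&` [set u | B (f u)])^°; first by split; [exact: open_interior|].
move=> k; apply: Ck_comp (gB k); first exact: open_interior.
  by move=> u /interior_subset[].
by apply: Ck_sub (fA k) => u /interior_subset[].
Qed.

End CinftyNearScalar.

Section Charts.
Context {R : realType} {n : nat} {T : topologicalType} (a : chart R n T).
Implicit Types (x : T) (u : 'rV[R]_n).

Lemma chart_dom_near x : chart_dom a x -> \forall y \near x, chart_dom a y.
Proof.
by move=> ax; apply: open_nbhs_nbhs; split=> //; exact: chart_dom_open.
Qed.

Lemma chart_im_near x : chart_dom a x ->
  \forall u \near chart_map a x, (chart_map a @` chart_dom a) u.
Proof.
by move=> ax; apply: open_nbhs_nbhs; split; [exact: chart_im_open|exists x].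
Qed.

Lemma chart_invK u : (chart_map a @` chart_dom a) u ->
  chart_map a (chart_inv a u) = u.
Proof. by move=> [x ax <-]; rewrite chart_mapK. Qed.

Lemma chart_map_near x (P : 'rV[R]_n -> Prop) : chart_dom a x ->
  (\forall u \near chart_map a x, P u) -> \forall y \near x, P (chart_map a y).
Proof. by move=> ax; apply: chart_map_cts. Qed.

Lemma chart_inv_near x (P : T -> Prop) : chart_dom a x ->
  (\forall y \near x, P y) -> \forall u \near chart_map a x, P (chart_inv a u).
Proof.
move=> ax xP; apply: (@chart_inv_cts _ _ _ a (chart_map a x)).
  by exists x.
by rewrite chart_mapK.
Qed.

End Charts.

Section SmoothFunctions.
Context {R : realType} {n : nat} {M : manifold R n}.
Implicit Types (x : M) (h k : M -> R).

Lemma transition_smooth x (a b : chart R n M) : atlas a -> atlas b ->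
  chart_dom a x -> chart_dom b x ->
  Cinfty_near (chart_map b x) (chart_map a \o chart_inv b).
Proof.
move=> Ma Mb ax bx; apply: Cinfty_nearW (atlas_smooth Mb Ma).
have := chart_inv_near bx (chart_dom_near ax).
have := chart_inv_near bx (chart_dom_near bx).
have := chart_im_near bx.
apply: filterS3 => u imu bu au.
by exists (chart_inv b u) => //; exact: chart_invK.
Qed.

(** One chart suffices, since the transition maps are smooth. *)
Lemma smooth_at_chart x h (a : chart R n M) : atlas a -> chart_dom a x ->
  Cinfty_near (chart_map a x) (h \o chart_inv a) -> smooth_at x h.
Proof.
move=> Ma ax ha b Mb bx.
have ta := transition_smooth Ma Mb ax bx.
apply: (@Cinfty_near_ext _ _ _ _
  ((h \o chart_inv a) \o (chart_map a \o chart_inv b))).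
  apply: filterS (chart_inv_near bx (chart_dom_near ax)) => u au /=.
  by rewrite chart_mapK.
by apply: Cinfty_near_comp => //=; rewrite chart_mapK.
Qed.

Lemma smooth_at_near x h : smooth_at x h -> \forall y \near x, smooth_at y h.
Proof.
move=> xh; have [a Ma ax] := atlas_cover x.
have := chart_map_near ax (Cinfty_near_nbhs (xh a Ma ax)).
apply: filterS2 (chart_dom_near ax) => y ay; exact: smooth_at_chart.
Qed.

Lemma smooth_at_ext x h k : (\forall y \near x, h y = k y) ->
  smooth_at x h -> smooth_at x k.
Proof.
move=> hk xh a Ma ax; apply: Cinfty_near_ext (xh a Ma ax).
exact: chart_inv_near ax hk.
Qed.

Lemma smooth_at_cst x (c : R) : smooth_at x (fun=> c).
Proof. by move=> a Ma ax; exact: Cinfty_near_cst. Qed.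

Lemma smooth_atD x h k : smooth_at x h -> smooth_at x k ->
  smooth_at x (fun y => h y + k y).
Proof.
by move=> xh xk a Ma ax; apply: Cinfty_nearD; [exact: xh|exact: xk].
Qed.

Lemma smooth_atM x h k : smooth_at x h -> smooth_at x k ->
  smooth_at x (fun y => h y * k y).
Proof.
by move=> xh xk a Ma ax; apply: Cinfty_nearM; [exact: xh|exact: xk].
Qed.

Lemma smooth_atV x h : h x != 0 -> smooth_at x h ->
  smooth_at x (fun y => (h y)^-1).
Proof.
move=> hx xh a Ma ax; apply: Cinfty_nearV (xh a Ma ax).
by rewrite /= chart_mapK.
Qed.

Lemma smooth_at_sum x (I : Type) (r : seq I) (F : I -> M -> R) :
  (forall i, smooth_at x (F i)) -> smooth_at x (fun y => \sum_(i <- r) F i y).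
Proof.
move=> xF; elim: r => [|i r IH].
  by under eq_fun do rewrite big_nil; exact: smooth_at_cst.
by under eq_fun do rewrite big_cons; exact: smooth_atD.
Qed.

Lemma smooth_at_prod x (I : Type) (r : seq I) (F : I -> M -> R) :
  (forall i, smooth_at x (F i)) -> smooth_at x (fun y => \prod_(i <- r) F i y).
Proof.
move=> xF; elim: r => [|i r IH].
  by under eq_fun do rewrite big_nil; exact: smooth_at_cst.
by under eq_fun do rewrite big_cons; exact: smooth_atM.
Qed.

Lemma smooth_at_continuous x h : smooth_at x h -> {for x, continuous h}.
Proof.
move=> xh; have [a Ma ax] := atlas_cover x.
have ch := Cinfty_near_continuous (xh a Ma ax).
have : {for x, continuous ((h \o chart_inv a) \o chart_map a)}.
  by apply: continuous_comp => //; exact: chart_map_cts.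
move=> c S hS; have := c S; rewrite /= chart_mapK // => /(_ hS).
by apply: filterS2 (chart_dom_near ax) => y ay /=; rewrite chart_mapK.
Qed.

Lemma smooth_at_chart_comp x (a : chart R n M) (q : 'rV[R]_n -> R) :
  atlas a -> chart_dom a x -> Cinfty_near (chart_map a x) q ->
  smooth_at x (q \o chart_map a).
Proof.
move=> Ma ax xq; apply: (smooth_at_chart Ma ax).
apply: Cinfty_near_ext xq; apply: filterS (chart_im_near ax) => u imu /=.
by rewrite chart_invK.
Qed.

Lemma smooth_at_coord x (a : chart R n M) s : atlas a -> chart_dom a x ->
  smooth_at x (fun y => chart_map a y 0 s).
Proof.
move=> Ma ax; apply: (@smooth_at_chart_comp x a (fun u => u 0 s)) => //.
by exists setT => [|k]; [split=> //; exact: openT|exact: Ck_rV_coord].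
Qed.

Lemma smooth_at_partial x (a : chart R n M) h v : atlas a -> chart_dom a x ->
  smooth_at x h ->
  smooth_at x (fun y => 'D_v (h \o chart_inv a) (chart_map a y)).
Proof.
move=> Ma ax xh.
apply: (@smooth_at_chart_comp x a ('D_v (h \o chart_inv a))) => //.
exact/Cinfty_near_derive/xh.
Qed.

End SmoothFunctions.

(** * Tangent vectors in charts *)

Section TangentVectors.
Context {R : realType} {n : nat} {M : manifold R n}.
Implicit Types (x : M) (h k : M -> R).

Lemma tangent_lin x (v : tangent x) (c : R) h k :
  smooth_at x h -> smooth_at x k -> v (fun y => c * h y + k y) = c * v h + v k.
Proof. by case: v => D [l m z] /=; exact: l. Qed.

Lemma tangentM x (v : tangent x) h k : smooth_at x h -> smooth_at x k ->
  v (fun y => h y * k y) = v h * k x + h x * v k.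
Proof. by case: v => D [l m z] /=; exact: m. Qed.

Lemma tangent_nonsmooth x (v : tangent x) h : ~ smooth_at x h -> v h = 0.
Proof. by case: v => D [l m z] /=; exact: z. Qed.

Lemma tangent_eq x (v w : tangent x) :
  (forall h, smooth_at x h -> v h = w h) -> v = w.
Proof.
move=> vw; apply: tangent_ext => h.
by have [/vw//|xh] := pselect (smooth_at x h); rewrite !tangent_nonsmooth.
Qed.

(** [h] is the product of itself with the indicator of the set where it does not
    vanish.  That indicator is 0 near [x], hence smooth there, and the Leibniz
    rule applied to the product gives 0. *)
Lemma tangent_local0 x (v : tangent x) h :
  (\forall y \near x, h y = 0) -> v h = 0.
Proof.
move=> h0; pose psi y : R := (h y != 0)%:R.
have psi0 : \forall y \near x, 0 = psi y.
  by apply: filterS h0 => y hy; rewrite /psi hy eqxx.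
have hE : (fun y => psi y * h y) = h.
  apply/funext => y; rewrite /psi; have [->|_] := eqVneq (h y) 0.
    by rewrite mul0r.
  by rewrite mul1r.
have xpsi := smooth_at_ext psi0 (@smooth_at_cst _ _ _ x 0).
have xh : smooth_at x h.
  apply: smooth_at_ext (@smooth_at_cst _ _ _ x 0).
  by apply: filterS h0 => y ->.
rewrite -hE tangentM // (nbhs_singleton h0).
by rewrite -(nbhs_singleton psi0) mulr0 mul0r addr0.
Qed.

Lemma tangent_local x (v : tangent x) h k :
  (\forall y \near x, h y = k y) -> v h = v k.
Proof.
move=> hk; have [xh|xh] := pselect (smooth_at x h); last first.
  have xk : ~ smooth_at x k.
    by move=> xk; apply: xh; apply: smooth_at_ext xk; apply: filterS hk => y ->.
  by rewrite !tangent_nonsmooth.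
have xk := smooth_at_ext hk xh.
apply/eqP; rewrite -subr_eq0; apply/eqP.
have := tangent_lin v (-1) xk xh; rewrite tangent_local0; last first.
  by apply: filterS hk => y ->; rewrite mulN1r addNr.
by move=> ->; rewrite mulN1r addrC.
Qed.

Lemma tangent_cst x (v : tangent x) (c : R) : v (fun=> c) = 0.
Proof.
have s1 := @smooth_at_cst _ _ _ x 1; have s0 := @smooth_at_cst _ _ _ x 0.
have v0 : v (fun=> 0) = 0 by apply: tangent_local0; exact: nearW.
have v1 : v (fun=> 1) = 0.
  have := tangentM v s1 s1; under [X in v X]eq_fun do rewrite mulr1.
  rewrite mulr1 mul1r => /eqP.
  by rewrite -subr_eq0 opprD addNKr oppr_eq0 => /eqP.
have := tangent_lin v c s1 s0; under [X in v X]eq_fun do rewrite mulr1 addr0.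
by rewrite v1 v0 mulr0 addr0.
Qed.

Lemma tangent_add x (v : tangent x) h k : smooth_at x h -> smooth_at x k ->
  v (fun y => h y + k y) = v h + v k.
Proof.
move=> xh xk; have := tangent_lin v 1 xh xk.
by under [X in v X]eq_fun do rewrite mul1r; rewrite mul1r.
Qed.

Lemma tangent_sumr x (v : tangent x) (I : Type) (r : seq I) (F : I -> M -> R) :
  (forall i, smooth_at x (F i)) ->
  v (fun y => \sum_(i <- r) F i y) = \sum_(i <- r) v (F i).
Proof.
move=> xF; elim: r => [|i r IH].
  by under [X in v X]eq_fun do rewrite big_nil; rewrite tangent_cst big_nil.
under [X in v X]eq_fun do rewrite big_cons.
by rewrite tangent_add ?IH ?big_cons //; exact: smooth_at_sum.
Qed.

Lemma tangent_suml x (I : Type) (r : seq I) (F : I -> tangent x) h :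
  (\sum_(i <- r) F i) h = \sum_(i <- r) F i h.
Proof. by elim: r => [|i r IH]; rewrite ?big_nil // !big_cons -IH. Qed.

(** A functional that satisfies the derivation rules on smooth germs becomes a
    tangent vector once it is set to 0 on the other functions. *)
Lemma derivation_vectorE x (D : (M -> R) -> R) :
  (forall (c : R) h k, smooth_at x h -> smooth_at x k ->
     D (fun y => c * h y + k y) = c * D h + D k) ->
  (forall h k, smooth_at x h -> smooth_at x k ->
     D (fun y => h y * k y) = D h * k x + h x * D k) ->
  forall h, smooth_at x h -> derivation_vector x D h = D h.
Proof.
move=> lD mD; pose D' h := if `[< smooth_at x h >] then D h else 0.
have D'E h : smooth_at x h -> D' h = D h by rewrite /D'; case: asboolP.
have D'P : derivation_at x D'.
  split=> [c h k xh xk|h k xh xk|h xh].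
  - rewrite !D'E ?lD //; apply: smooth_atD => //; apply: smooth_atM => //.
    exact: smooth_at_cst.
  - by rewrite !D'E ?mD //; exact: smooth_atM.
  - by rewrite /D'; case: asboolP.
have := @xgetPex _ 0 [set v : tangent x | forall h, smooth_at x h -> v h = D h].
by apply; exists (Tangent D'P) => h /D'E.
Qed.

Definition partial_vector x (a : chart R n M) (w : 'rV[R]_n) : tangent x :=
  derivation_vector x (fun h => 'D_w (h \o chart_inv a) (chart_map a x)).

Lemma partial_vectorE x (a : chart R n M) w h : atlas a -> chart_dom a x ->
  smooth_at x h ->
  partial_vector x a w h = 'D_w (h \o chart_inv a) (chart_map a x).
Proof.
move=> Ma ax; apply: derivation_vectorE => {h} [c h k xh xk|h k xh xk].
- have dh := Cinfty_near_differentiable (xh _ Ma ax).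
  have dk := Cinfty_near_differentiable (xk _ Ma ax).
  have := @deriveD _ _ _ (c *: (h \o chart_inv a)) (k \o chart_inv a)
    (chart_map a x) w.
  rewrite deriveZ; last exact: diff_derivable.
  by apply; [apply: derivableZ|]; exact: diff_derivable.
- have dh := Cinfty_near_differentiable (xh _ Ma ax).
  have dk := Cinfty_near_differentiable (xk _ Ma ax).
  have := @deriveM _ _ (h \o chart_inv a) (k \o chart_inv a) (chart_map a x) w
    (diff_derivable dh) (diff_derivable dk).
  by rewrite /= chart_mapK // addrC [X in _ = X + _]mulrC.
Qed.

Lemma partial_vector_coord x (a : chart R n M) w s : atlas a -> chart_dom a x ->
  partial_vector x a w (fun y => chart_map a y 0 s) = w 0 s.
Proof.
move=> Ma ax; rewrite partial_vectorE //; last exact: smooth_at_coord.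
rewrite -[RHS](derive_rV_coord (chart_map a x)); apply: near_eq_derive.
by apply: filterS (chart_im_near ax) => u imu /=; rewrite chart_invK.
Qed.

(** By Hadamard's lemma, any tangent vector takes [h] to the combination of the
    values [v u_s] with coefficients the quotients of [h] at [x]; applying this
    to the partial derivatives identifies the coefficients. *)
Lemma tangent_chart x (v : tangent x) (a : chart R n M) h :
  atlas a -> chart_dom a x -> smooth_at x h ->
  v h = \sum_s 'D_(delta_mx 0 s) (h \o chart_inv a) (chart_map a x) *
               v (fun y => chart_map a y 0 s).
Proof.
move=> Ma ax xh; have [q qs hE] := hadamard (xh a Ma ax).
have xu s := @smooth_at_coord _ _ _ x a s Ma ax.
have xq s := smooth_at_chart_comp Ma ax (qs s).
have H (w : tangent x) : w h =
    \sum_s q s (chart_map a x) * w (fun y => chart_map a y 0 s).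
  pose F s y := (chart_map a y 0 s + - chart_map a x 0 s) * q s (chart_map a y).
  have xF1 s : smooth_at x (fun y => chart_map a y 0 s + - chart_map a x 0 s).
    by apply: smooth_atD => //; exact: smooth_at_cst.
  have xF s : smooth_at x (F s) by apply: smooth_atM; [exact: xF1|exact: xq].
  rewrite (@tangent_local _ w _ (fun y => h x + \sum_s F s y)); last first.
    apply: filterS2 (chart_map_near ax hE) (chart_dom_near ax) => y /= + ay.
    by rewrite !chart_mapK.
  rewrite tangent_add ?tangent_cst ?add0r ?tangent_sumr //; last 2 first.
  - exact: smooth_at_cst.
  - exact: smooth_at_sum.
  apply: eq_bigr => s _; rewrite (tangentM w (xF1 s) (xq s)) /=.
  rewrite subrr mul0r addr0 mulrC.
  congr (_ * _); rewrite tangent_add //; last exact: smooth_at_cst.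
  by rewrite tangent_cst addr0.
rewrite H; apply: eq_bigr => s _; congr (_ * _).
rewrite -partial_vectorE // H (bigD1 s) //= big1 => [|t ts].
  by rewrite partial_vector_coord // mxE !eqxx mulr1 addr0.
by rewrite partial_vector_coord // mxE (negPf ts) mulr0.
Qed.

End TangentVectors.

(** * The differential of a smooth map *)

Section Pushforward.
Context {R : realType} {k n : nat} {L : manifold R k} {M : manifold R n}.
Context (iota : L -> M) (iota_smooth : smooth_map iota).
Implicit Types (y : L) (h : M -> R).

Lemma smooth_at_comp y h : smooth_at (iota y) h -> smooth_at y (h \o iota).
Proof.
move=> yh; have [ci si] := iota_smooth.
have [a La ay] := atlas_cover y; have [b Mb biy] := atlas_cover (iota y).
apply: (smooth_at_chart La ay).
apply: (@Cinfty_near_ext _ _ _ _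
  ((h \o chart_inv b) \o (chart_map b \o iota \o chart_inv a))).
  have near_b : \forall z \near y, chart_dom b (iota z).
    exact: (ci y _ (chart_dom_near biy)).
  apply: filterS (chart_inv_near ay near_b) => u bu /=.
  by rewrite chart_mapK.
apply: Cinfty_near_comp; first exact: si.
by rewrite /= chart_mapK //; exact: yh.
Qed.

Lemma pushforwardE y (v : tangent y) h : smooth_at (iota y) h ->
  pushforward iota v h = v (h \o iota).
Proof.
apply: derivation_vectorE => {h} [c h l yh yl|h l yh yl].
- exact: (tangent_lin v c (smooth_at_comp yh) (smooth_at_comp yl)).
- exact: (tangentM v (smooth_at_comp yh) (smooth_at_comp yl)).
Qed.

Lemma pushforwardD y (v w : tangent y) :
  pushforward iota (v + w) = pushforward iota v + pushforward iota w.
Proof.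
by apply: tangent_eq => h yh; rewrite [RHS]/= !pushforwardE.
Qed.

Lemma pushforwardZ y (c : R) (v : tangent y) :
  pushforward iota (c *: v) = c *: pushforward iota v.
Proof. by apply: tangent_eq => h yh; rewrite [RHS]/= !pushforwardE. Qed.

Lemma pushforward_sum y (I : Type) (r : seq I) (F : I -> tangent y) :
  pushforward iota (\sum_(i <- r) F i) = \sum_(i <- r) pushforward iota (F i).
Proof.
elim: r => [|i r IH]; last by rewrite !big_cons pushforwardD IH.
rewrite !big_nil -[X in pushforward _ X](scale0r (0 : tangent y)).
by rewrite pushforwardZ scale0r.
Qed.

End Pushforward.

(** * Restricting a tangent field to an immersed submanifold *)

Section SmoothMatrices.
Context {R : realType} {n : nat} {M : manifold R n}.
Variable x : M.

Definition smooth_mx p q (A : M -> 'M[R]_(p, q)) :=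
  forall i j, smooth_at x (fun y => A y i j).

Lemma smooth_mulmx p q r (A : M -> 'M[R]_(p, q)) (B : M -> 'M[R]_(q, r)) :
  smooth_mx A -> smooth_mx B -> smooth_mx (fun y => A y *m B y).
Proof.
move=> sA sB i j; under eq_fun do rewrite mxE.
by apply: smooth_at_sum => l; apply: smooth_atM; [exact: sA|exact: sB].
Qed.

Lemma smooth_det p (A : M -> 'M[R]_p) :
  smooth_mx A -> smooth_at x (fun y => \det (A y)).
Proof.
move=> sA; apply: smooth_at_sum => s; apply: smooth_atM.
  exact: smooth_at_cst.
by apply: smooth_at_prod => i; exact: sA.
Qed.

Lemma smooth_adj p (A : M -> 'M[R]_p) :
  smooth_mx A -> smooth_mx (fun y => \adj (A y)).
Proof.
move=> sA i j; under eq_fun do rewrite mxE.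
apply: smooth_atM; first exact: smooth_at_cst.
apply: smooth_det => s t; under eq_fun do rewrite !mxE; exact: sA.
Qed.

End SmoothMatrices.

Lemma tangent_coord_eq {R : realType} {n : nat} {M : manifold R n} (x : M)
    (a : chart R n M) (v w : tangent x) : atlas a -> chart_dom a x ->
  (forall s, v (fun y => chart_map a y 0 s) = w (fun y => chart_map a y 0 s)) ->
  v = w.
Proof.
move=> Ma ax vw; apply: tangent_eq => h xh.
by rewrite !(tangent_chart _ Ma ax xh); apply: eq_bigr => s _; rewrite vw.
Qed.

Section RestrictField.
Context {R : realType} {k n : nat} {L : manifold R k} {M : manifold R n}.
Context (iota : L -> M) (iota_imm : injective_immersion iota).

Let iota_smooth : smooth_map iota. Proof. by case: iota_imm. Qed.

Definition jacobian_mx (a : chart R k L) (b : chart R n M) (y : L)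
    : 'M[R]_(k, n) :=
  \matrix_(s, l) 'D_(delta_mx 0 s)
    ((fun z => chart_map b (iota z) 0 l) \o chart_inv a) (chart_map a y).

(** A vector in the row kernel gives a tangent vector of [L] whose image kills
    the coordinates of [M], hence is 0; as the differential is injective, that
    vector is 0. *)
Lemma jacobian_row_free (a : chart R k L) (b : chart R n M) y :
  atlas a -> chart_dom a y -> atlas b -> chart_dom b (iota y) ->
  row_free (jacobian_mx a b y).
Proof.
move=> La ay Mb biy; have [_ _ push_inj] := iota_imm.
have xphi l := @smooth_at_coord _ _ _ (iota y) b l Mb biy.
have yphi l := smooth_at_comp iota_smooth (xphi l).
apply: inj_row_free => v vJ.
have wE l : partial_vector y a v (fun z => chart_map b (iota z) 0 l) = 0.
  rewrite (partial_vectorE _ La ay (yphi l)) derive_partial; last first.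
    exact/Cinfty_near_differentiable/yphi.
  have /rowP/(_ l) := vJ; rewrite !mxE => E; rewrite -[RHS]E.
  by apply: eq_bigr => s _; rewrite mxE.
have w0 : partial_vector y a v = 0.
  apply: push_inj; apply: (tangent_coord_eq Mb biy) => l.
  by rewrite !pushforwardE // wE.
apply/rowP => s; rewrite mxE -(partial_vector_coord v s La ay) w0.
by [].
Qed.

Lemma pushforward_restrict (X : vector_field M) y :
  range (@Defs.pushforward _ _ _ _ _ iota y) (X (iota y)) ->
  pushforward iota (restrict_field iota X y) = X (iota y).
Proof.
move=> [v _ vX].
exact: (@xgetPex _ 0 [set v : tangent y | pushforward iota v = X (iota y)]
  (ex_intro _ v vX)).
Qed.

(** The row [c y] of components of the restricted field in a chart of [L]
    satisfies [c y *m B y = m y], where [B] is the Jacobian matrix of the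
    immersion and [m] the row of components of [X] along it.  Multiplying by a
    fixed right inverse [C] of [B y0] makes the system square, and invertible
    near [y0], so that [c] is given by Cramer's rule in terms of [m] and [B]. *)
Lemma restrict_field_smooth (U : set M) (X : vector_field M) :
  range iota `<=` U -> smooth_field U X ->
  (forall y, range (@Defs.pushforward _ _ _ _ _ iota y) (X (iota y))) ->
  smooth_field [set: L] (restrict_field iota X).
Proof.
move=> iU sX rX y0 h _ yh.
have [ci si] := iota_smooth.
have [a La ay0] := atlas_cover y0; have [b Mb biy0] := atlas_cover (iota y0).
pose phi l (z : M) := chart_map b z 0 l.
have xphi l : smooth_at (iota y0) (phi l) by exact: smooth_at_coord.
have yphi l : smooth_at y0 (phi l \o iota) by exact: smooth_at_comp.
pose F := restrict_field iota X.
pose B := jacobian_mx a b.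
pose c y : 'rV[R]_k := \row_s F y (fun z => chart_map a z 0 s).
pose m y : 'rV[R]_n := \row_l X (iota y) (phi l).
pose C := pinvmx (B y0).
pose G y := B y *m C.
have sB : smooth_mx y0 B.
  move=> s l; under eq_fun do rewrite mxE.
  by apply: smooth_at_partial => //; exact: yphi.
have sm : smooth_mx y0 m.
  move=> i l; under eq_fun do rewrite mxE.
  apply: (smooth_at_comp iota_smooth (h := fun z => X z (phi l))).
  by apply: sX => //; apply: iU; exists y0.
have sC : smooth_mx y0 (fun=> C) by move=> i j; exact: smooth_at_cst.
have sG : smooth_mx y0 G by exact: smooth_mulmx.
have sd := smooth_det sG.
have d0 : \det (G y0) != 0.
  by rewrite /G /C mulmxVp ?det1 ?oner_neq0 //; exact: jacobian_row_free.
have sdV := smooth_atV d0 sd.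
have cB : \forall y \near y0, c y *m B y = m y.
  have near_phi : \forall y \near y0, forall l,
      smooth_at (iota y) (phi l) /\ smooth_at y (phi l \o iota).
    apply: filter_forall => l; apply: filterI.
      exact: (ci y0 _ (smooth_at_near (xphi l))).
    exact: smooth_at_near (yphi l).
  apply: filterS2 near_phi (chart_dom_near ay0) => y xy ay.
  apply/rowP => l; rewrite !mxE.
  have [xl yl] := xy l.
  rewrite -(pushforward_restrict (rX y)) pushforwardE //.
  rewrite (tangent_chart _ La ay yl); apply: eq_bigr => s _.
  by rewrite !mxE mulrC.
pose c' y := m y *m C *m \adj (G y).
have sc' : smooth_mx y0 c'.
  by apply: smooth_mulmx; [exact: smooth_mulmx|exact: smooth_adj].
have cE : \forall y \near y0, c y = (\det (G y))^-1 *: c' y.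
  have nd : \forall y \near y0, \det (G y) != 0.
    exact: (smooth_at_continuous sd (open_nbhs_nbhs (conj (@open_neq R 0) d0))).
  apply: filterS2 cB nd => y cBy dy.
  rewrite /c' -cBy -(mulmxA (c y)) -/(G y) -mulmxA mul_mx_adj.
  by rewrite mul_mx_scalar scalerA mulVf // scale1r.
(* Near y0, the derivative of h along the field is this combination of the
   partial derivatives of h. *)
apply: (@smooth_at_ext _ _ _ y0 (fun y => \sum_s
    'D_(delta_mx 0 s) (h \o chart_inv a) (chart_map a y) *
    ((\det (G y))^-1 * c' y 0 s))).
  apply: filterS3 cE (chart_dom_near ay0) (smooth_at_near yh) => y cy ay hy.
  rewrite (tangent_chart _ La ay hy); apply: eq_bigr => s _.
  have /rowP/(_ s) := cy; rewrite !mxE => <-.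
  by [].
apply: smooth_at_sum => s; apply: smooth_atM; first exact: smooth_at_partial.
by apply: smooth_atM; [exact: sdV|exact: sc'].
Qed.

End RestrictField.

(** * Orthonormal frames *)

Section OrthonormalFamily.
Context {R : realType} {V : lmodType R} {I : finType}.
Variables (b : V -> V -> R) (e : I -> V).
Hypothesis b_lin : forall (c : R) (u v w : V),
  b (c *: u + v) w = c * b u w + b v w.
Hypothesis b_sym : forall u v : V, b u v = b v u.
Hypothesis e_orth : forall i j, b (e i) (e j) = (i == j)%:R.

Lemma form_suml (c : I -> R) (w : V) :
  b (\sum_i c i *: e i) w = \sum_i c i * b (e i) w.
Proof.
have b0 : b 0 w = 0.
  have := b_lin 1 0 0 w; rewrite scaler0 addr0 mul1r => /eqP.
  by rewrite -subr_eq0 opprD addNKr oppr_eq0 => /eqP.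
by elim/big_rec2: _ => // i y v _ <-; rewrite b_lin.
Qed.

Lemma orthonormal_coord (c : I -> R) j : b (\sum_i c i *: e i) (e j) = c j.
Proof.
rewrite form_suml (bigD1 j) //= e_orth eqxx mulr1 big1 ?addr0 // => i ij.
by rewrite e_orth (negPf ij) mulr0.
Qed.

Lemma orthonormal_expand (v : V) : (exists c, v = \sum_i c i *: e i) ->
  v = \sum_i b v (e i) *: e i.
Proof.
by move=> [c ->]; apply: eq_bigr => i _; rewrite orthonormal_coord.
Qed.

End OrthonormalFamily.

Section MetricFrames.
Context {R : realType} {n : nat} {M : manifold R n} {I : finType}.
Variables (g : metric_tensor M) (x : M) (e : I -> tangent x).
Hypothesis g_lin : forall (c : R) (u v w : tangent x),
  g (c *: u + v) w = c * g u w + g v w.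
Hypothesis g_sym : forall u v : tangent x, g u v = g v u.
Hypothesis e_orth : forall i j, g (e i) (e j) = (i == j)%:R.

Lemma gradient_frame (h : M -> R) :
  (forall v : tangent x, exists c, v = \sum_i c i *: e i) ->
  gradient g h x = \sum_i e i h *: e i /\
  forall w, g (gradient g h x) w = w h.
Proof.
move=> e_span.
have grad w : g (\sum_i e i h *: e i) w = w h.
  rewrite (form_suml e g_lin).
  rewrite [in RHS](orthonormal_expand g_lin e_orth (e_span w)) tangent_suml.
  by apply: eq_bigr => i _; rewrite g_sym mulrC.
suff -> : gradient g h x = \sum_i e i h *: e i by [].
apply: xget_subset1 => // u v /= hu hv.
rewrite (orthonormal_expand g_lin e_orth (e_span u)).
rewrite (orthonormal_expand g_lin e_orth (e_span v)).
by apply: eq_bigr => i _; rewrite hu hv.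
Qed.

Lemma orth_proj_frame (E : tangent_distribution M) (v : tangent x) :
  (forall w, E x w <-> exists c, w = \sum_i c i *: e i) ->
  orth_proj g E v = \sum_i g v (e i) *: e i.
Proof.
move=> EE; set w0 := (X in _ = X).
have gB (u w : tangent x) : g (v - u) w = g v w - g u w.
  by rewrite -scaleN1r addrC g_lin mulN1r addrC.
have w0e i : g w0 (e i) = g v (e i) by rewrite (orthonormal_coord g_lin e_orth).
apply: xget_subset1.
  split=> [|u /EE /(orthonormal_expand g_lin e_orth) ->].
    by apply/EE; exists (fun i => g v (e i)).
  rewrite g_sym (form_suml e g_lin) big1 // => i _.
  by rewrite [X in _ * X]g_sym gB w0e subrr mulr0.
have uniq_w (w : tangent x) : (E x w /\ forall u, E x u -> g (v - w) u = 0) ->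
    w = w0.
  move=> [Ew wv]; rewrite ((orthonormal_expand g_lin e_orth) _ ((EE w).1 Ew)).
  apply: eq_bigr => i _; congr (_ *: _).
  have /wv/eqP : E x (e i).
    apply/EE; exists (fun j => (j == i)%:R).
    rewrite (bigD1 i) //= eqxx scale1r big1 ?addr0 // => j /negPf ->.
    by rewrite scale0r.
  by rewrite gB subr_eq0 => /eqP.
by move=> u w /uniq_w -> /uniq_w ->.
Qed.

End MetricFrames.

(** * Connections and brackets *)

Section Connections.
Context {R : realType} {n : nat} {M : manifold R n}.
Variable U : set M.
Variable nabla : vector_field M -> vector_field M -> vector_field M.
Hypothesis U_open : open U.
Hypothesis nabla_aff : affine_connection U nabla.
Implicit Types (X Y : vector_field M).

Lemma open_near x : U x -> \forall y \near x, U y.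
Proof. by move=> Ux; apply: open_nbhs_nbhs. Qed.

Lemma smooth_field_ext X Y : (forall x, U x -> X x = Y x) ->
  smooth_field U X -> smooth_field U Y.
Proof.
move=> XY sX x h Ux xh; apply: smooth_at_ext (sX x h Ux xh).
by apply: filterS (open_near Ux) => y /XY ->.
Qed.

Lemma smooth_field_sum (I : Type) (r : seq I) (a : I -> M -> R)
    (e : I -> vector_field M) :
  (forall i, smooth_on U (a i)) -> (forall i, smooth_field U (e i)) ->
  smooth_field U (fun y => \sum_(i <- r) a i y *: e i y).
Proof.
move=> sa se x h Ux xh.
under eq_fun do rewrite tangent_suml.
apply: smooth_at_sum => i; apply: smooth_atM; [exact: sa|exact: se].
Qed.

(** Locality of the connection over [U]: [Y] is unchanged by multiplication with
    the indicator of the complement of [U], a function that vanishes on [U], so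
    both terms of the Leibniz rule are 0. *)
Lemma connection0 X Y x : smooth_field U X -> (forall y, U y -> Y y = 0) ->
  U x -> nabla X Y x = 0.
Proof.
move=> sX Y0 Ux; have [_ _ _ leibniz] := nabla_aff.
pose a y : R := if `[< U y >] then 0 else 1.
have aE y : U y -> a y = 0 by rewrite /a; case: asboolP.
have sa : smooth_on U a.
  move=> y Uy; apply: smooth_at_ext (@smooth_at_cst _ _ _ y 0).
  by apply: filterS (open_near Uy) => z /aE.
have sY : smooth_field U Y.
  move=> y h Uy yh; apply: smooth_at_ext (@smooth_at_cst _ _ _ y 0).
  by apply: filterS (open_near Uy) => z /Y0 ->.
have aY : (fun y => a y *: Y y) = Y.
  apply/functional_extensionality_dep => y; rewrite /a.
  case: asboolP => [/Y0 ->|_].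
    by rewrite scaler0.
  by rewrite scale1r.
by rewrite -aY leibniz // Y0 // aE // scaler0 scale0r addr0.
Qed.

Lemma connection_ext X Y Y' x : smooth_field U X -> smooth_field U Y ->
  (forall y, U y -> Y y = Y' y) -> U x -> nabla X Y x = nabla X Y' x.
Proof.
move=> sX sY YY' Ux; have [_ _ add _] := nabla_aff.
pose D : vector_field M := fun y => Y' y - Y y.
have D0 y : U y -> D y = 0 by move=> Uy; rewrite /D (YY' _ Uy) subrr.
have sD : smooth_field U D.
  apply: (@smooth_field_ext (fun=> 0)) => [y /D0 ->//|y h _ _].
  exact: smooth_at_cst.
have -> : Y' = (fun y => Y y + D y).
  by apply/functional_extensionality_dep => y; rewrite /D addrC subrK.
by rewrite add // (connection0 sX D0 Ux) addr0.
Qed.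

(** At a common zero of the coefficients only their derivatives survive in the
    Leibniz rule. *)
Lemma connection_critical (I : Type) (r : seq I) (a : I -> M -> R)
    (e : I -> vector_field M) X x :
  smooth_field U X ->
  (forall i, smooth_on U (a i)) -> (forall i, smooth_field U (e i)) ->
  U x -> (forall i, a i x = 0) ->
  nabla X (fun y => \sum_(i <- r) a i y *: e i y) x =
  \sum_(i <- r) X x (a i) *: e i x.
Proof.
move=> sX sa se Ux a0; have [_ _ add leibniz] := nabla_aff.
elim: r => [|i r IH].
  by rewrite big_nil connection0 // => y _; rewrite big_nil.
have -> : (fun y => \sum_(j <- i :: r) a j y *: e j y) =
    (fun y => a i y *: e i y + \sum_(j <- r) a j y *: e j y).
  by apply/functional_extensionality_dep => y; rewrite big_cons.
rewrite big_cons add //; last exact: smooth_field_sum.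
  by rewrite IH leibniz // a0 scale0r addr0.
move=> y h Uy yh; apply: smooth_atM; [exact: sa|exact: se].
Qed.

(** [Y y] satisfies the derivation rules for two given functions only at the
    points [y] where these are smooth, that is near [x]; locality of tangent
    vectors makes this enough for the commutator to be a derivation at [x]. *)
Lemma lie_bracketE X Y x h : smooth_field U X -> smooth_field U Y -> U x ->
  smooth_at x h ->
  lie_bracket X Y x h = X x (fun y => Y y h) - Y x (fun y => X y h).
Proof.
move=> sX sY Ux.
have lin (Z : vector_field M) (c : R) (f1 f2 : M -> R) :
  smooth_at x f1 -> smooth_at x f2 ->
  \forall y \near x, Z y (fun y => c * f1 y + f2 y) = c * Z y f1 + Z y f2.
  move=> /smooth_at_near n1 /smooth_at_near n2.
  by apply: filterS2 n1 n2 => y y1 y2; exact: (tangent_lin (Z y) c y1 y2).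
have mul (Z : vector_field M) (f1 f2 : M -> R) :
  smooth_at x f1 -> smooth_at x f2 ->
  \forall y \near x, Z y (fun y => f1 y * f2 y) = Z y f1 * f2 y + f1 y * Z y f2.
  move=> /smooth_at_near n1 /smooth_at_near n2.
  by apply: filterS2 n1 n2 => y y1 y2; exact: (tangentM (Z y) y1 y2).
apply: derivation_vectorE => {h} [c f1 f2 s1 s2|f1 f2 s1 s2].
- rewrite (tangent_local _ (lin Y c _ _ s1 s2))
    (tangent_local _ (lin X c _ _ s1 s2)).
  rewrite !tangent_lin //; [ring|exact: sX|exact: sX|exact: sY|exact: sY].
- have [X1 X2] := (sX _ _ Ux s1, sX _ _ Ux s2).
  have [Y1 Y2] := (sY _ _ Ux s1, sY _ _ Ux s2).
  rewrite (tangent_local _ (mul Y _ _ s1 s2))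
    (tangent_local _ (mul X _ _ s1 s2)).
  rewrite !tangent_add; try exact: smooth_atM.
  by rewrite !tangentM //; ring.
Qed.

End Connections.

(** * The diagonal blocks of the intrinsic Jacobian *)

Lemma direct_sum_span {R : realType} {V : lmodType R} (N : nat)
    (d : 'I_N -> nat) (b : forall i, 'I_(d i) -> V) (E : 'I_N -> set V) :
  (forall i, E i = lin_span (b i)) -> direct_sum E ->
  forall v, exists c : {i : 'I_N & 'I_(d i)} -> R,
    v = \sum_s c s *: b (tag s) (tagged s).
Proof.
move=> EE [sumE _] v; have [w Ew ->] := sumE v.
have cP i : exists c : 'I_(d i) -> R, w i = \sum_p c p *: b i p.
  by have := Ew i; rewrite EE.
pose c i := projT1 (cid (cP i)).
exists (fun s => c (tag s) (tagged s)).
rewrite -(@sig_big_dep _ _ _ _ _ xpredT (fun=> xpredT)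
  (fun i p => c i p *: b i p)) /=.
by apply: eq_bigr => i _; rewrite {1}(projT2 (cid (cP i))).
Qed.

Section BlockFrame.
Context {R : realType} {n : nat} {M : manifold R n} {N : nat} {d : 'I_N -> nat}.
Variables (g : metric_tensor M) (x : M).
Variable f : forall i : 'I_N, 'I_(d i) -> tangent x.
Arguments f : clear implicits.
Hypothesis g_lin : forall (c : R) (u v w : tangent x),
  g (c *: u + v) w = c * g u w + g v w.
Hypothesis g_sym : forall u v : tangent x, g u v = g v u.
Hypothesis f_orth : forall i p j q,
  g (f i p) (f j q) =
  (Tagged (fun i : 'I_N => 'I_(d i)) p == Tagged _ q)%:R.
Hypothesis f_span : direct_sum (fun i => lin_span (f i)).

Lemma block_orth i p q : g (f i p) (f i q) = (p == q)%:R.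
Proof. by rewrite f_orth eq_Tagged. Qed.

Lemma dist_gradient_frame (E : tangent_distribution M) i (h : M -> R) :
  E x = lin_span (f i) ->
  dist_gradient g E h x = \sum_p f i p h *: f i p.
Proof.
move=> EE.
have [|_ gradE] := gradient_frame (e := fun s => f (tag s) (tagged s))
  g_lin g_sym _ h (direct_sum_span (fun=> erefl) f_span).
  by move=> [j p] [k q]; exact: f_orth.
rewrite /dist_gradient (orth_proj_frame g_lin g_sym (@block_orth i)).
  by apply: eq_bigr => p _; rewrite gradE.
by move=> w; rewrite EE.
Qed.

End BlockFrame.

Theorem proposition3 (R : realType) (n : nat) (M : manifold R n)
  (N : nat) (d : 'I_N -> nat)
  (f : forall i : 'I_N, 'I_(d i) -> vector_field M)
  (J : 'I_N -> M -> R)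
  (f_smooth : forall i j, smooth_field [set: M] (f i j))
  (J_smooth : forall i, smooth_on [set: M] (J i))
  (U : set M) (U_open : open U)
  (E : 'I_N -> tangent_distribution M)
  (E_def : forall i x, E i x = lin_span (fun j => f i j x))
  (E_regular : forall i, regular_distribution U (E i))
  (E_sum : forall x, U x -> direct_sum (fun i => E i x))
  (f_indep : forall i x, U x -> lin_indep (fun j => f i j x))
  (f_involutive : forall i p q x, U x -> E i x (lie_bracket (f i p) (f i q) x))
  (g : metric_tensor M) (g_metric : riemannian_metric U g)
  (g_orthonormal : forall x, U x -> forall i p j q,
     g x (f i p x) (f j q x) =
     (Tagged (fun i : 'I_N => 'I_(d i)) p == Tagged _ q)%:R)
  (nabla : vector_field M -> vector_field M -> vector_field M)
  (nabla_LC : levi_civita U g nabla)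
  (xs : M) (xs_U : U xs)
  (xs_critical : forall i, dist_gradient g (E i) (J i) xs = 0)
  (A : forall i j : 'I_N, 'M[R]_(d i, d j))
  (A_def : forall j q,
     intrinsic_jacobian g nabla E J (f j q) xs =
     \sum_(i < N) \sum_(p < d i) A i j p q *: f i p xs)
  (i : 'I_N) (L : manifold R (d i)) (iota : L -> M)
  (L_leaf : is_leaf U (E i) xs iota)
  (nablai : vector_field L -> vector_field L -> vector_field L)
  (nablai_LC : levi_civita [set: L] (induced_metric iota g) nablai)
  (ys : L) (ys_xs : iota ys = xs) (p q : 'I_(d i)) :
  A i i p q =
  hessian (induced_metric iota g) nablai (J i \o iota)
    (restrict_field iota (f i p)) (restrict_field iota (f i q)) ys.
Proof.
have [g_lin g_sym _ _] := g_metric.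
pose a j r x := f j r x (J j).
have f_smoothU j r : smooth_field U (f j r) by move=> x h _; exact: f_smooth.
have a_smooth j r : smooth_on [set: M] (a j r).
  by move=> x _; apply: f_smooth => //; exact: J_smooth.
have f_sum x : U x -> direct_sum (fun j => lin_span (fun r => f j r x)).
  by move=> /E_sum; under eq_fun do rewrite E_def.
have gradE j x : U x ->
    dist_gradient g (E j) (J j) x = \sum_r a j r x *: f j r x.
  move=> Ux; exact: (dist_gradient_frame (g_lin x Ux) (g_sym x Ux)
    (g_orthonormal x Ux) (f_sum x Ux) _ (E_def j x)).
have a0 j r : a j r xs = 0.
  by apply: (f_indep j xs xs_U (fun r => a j r xs)); rewrite -gradE.
(* The coordinate of the Jacobian along f i p, in the frame indexed by all the
   pairs (j, r). *)
have AE : A i i p q = f i q xs (a i p).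
  pose I := {j : 'I_N & 'I_(d j)}.
  pose e (s : I) := f (tag s) (tagged s).
  pose aa (s : I) := a (tag s) (tagged s).
  have e_orth (s t : I) : g xs (e s xs) (e t xs) = (s == t)%:R.
    by case: s t => [j r] [k t]; exact: g_orthonormal.
  have [nabla_aff _ _] := nabla_LC.
  have jacE : intrinsic_jacobian g nabla E J (f i q) xs =
      \sum_s f i q xs (aa s) *: e s xs.
    have aa_smooth s : smooth_on U (aa s) by move=> x _; exact: a_smooth.
    have e_smooth s : smooth_field U (e s) by exact: f_smoothU.
    rewrite -(connection_critical U_open nabla_aff (index_enum I)
      (f_smoothU i q) aa_smooth e_smooth xs_U (fun s => a0 _ _)).
    apply/esym/(connection_ext U_open nabla_aff) => //.
      exact: smooth_field_sum.
    move=> x Ux; rewrite -(@sig_big_dep _ _ _ _ _ xpredT (fun=> xpredT)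
      (fun j r => a j r x *: f j r x)) /=.
    by apply: eq_bigr => j _; rewrite gradE.
  have := A_def i q; rewrite jacE.
  rewrite (@sig_big_dep _ _ _ _ _ xpredT (fun=> xpredT)
    (fun j r => A j i r q *: f j r xs)) /=.
  move=> /(congr1 (fun v => g xs v (e (Tagged _ p) xs))).
  rewrite (orthonormal_coord (g_lin xs xs_U) e_orth).
  by rewrite (orthonormal_coord (g_lin xs xs_U) e_orth).
have [[iota_imm iota_U _ iota_tan] _ _] := L_leaf.
have [iota_smooth _ push_inj] := iota_imm.
(* From here on, the Hessian is computed in the frame F of the leaf. *)
pose F r := restrict_field iota (f i r).
have f_tan r y : range (@Defs.pushforward _ _ _ _ _ iota y) (f i r (iota y)).
  rewrite iota_tan E_def; exists (fun s => (s == r)%:R).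
  rewrite (bigD1 r) //= eqxx scale1r big1 ?addr0 // => s /negPf ->.
  by rewrite scale0r.
have pushF r y : pushforward iota (F r y) = f i r (iota y).
  exact/pushforward_restrict/f_tan.
have Ui y : U (iota y) by apply: iota_U; exists y.
have F_smooth r : smooth_field [set: L] (F r).
  exact: (restrict_field_smooth iota_imm iota_U).
have FE r y h : smooth_at (iota y) h -> F r y (h \o iota) = f i r (iota y) h.
  by move=> yh; rewrite -pushF pushforwardE.
pose gi := induced_metric iota g.
have gi_lin y (c : R) (u v w : tangent y) :
    gi y (c *: u + v) w = c * gi y u w + gi y v w.
  by rewrite /gi /induced_metric pushforwardD // pushforwardZ // g_lin.
have gi_sym y (u v : tangent y) : gi y u v = gi y v u by exact: g_sym.
have F_orth y r s : gi y (F r y) (F s y) = (r == s)%:R.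
  rewrite /gi /induced_metric !pushF.
  by rewrite g_orthonormal // eq_Tagged.
have F_span y (v : tangent y) : exists c, v = \sum_r c r *: F r y.
  have : range (@Defs.pushforward _ _ _ _ _ iota y) (pushforward iota v).
    by exists v.
  rewrite iota_tan E_def => -[c vc]; exists c; apply: push_inj.
  rewrite vc pushforward_sum //; apply: eq_bigr => r _.
  by rewrite pushforwardZ // pushF.
have hgradE : gradient gi (J i \o iota) =
    fun y => \sum_r (a i r \o iota) y *: F r y.
  apply/functional_extensionality_dep => y.
  have [-> _] := gradient_frame (gi_lin y) (gi_sym y) (F_orth y)
    (J i \o iota) (F_span y).
  by apply: eq_bigr => r _; rewrite FE //; exact: J_smooth.
have [nablai_aff _ _] := nablai_LC.
have b_smooth r : smooth_on [set: L] (a i r \o iota).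
  by move=> y _; apply: smooth_at_comp => //; exact: a_smooth.
have b0 r : (a i r \o iota) ys = 0 by rewrite /= ys_xs.
rewrite /hessian hgradE (connection_critical openT nablai_aff (index_enum _)
  (F_smooth p) b_smooth F_smooth _ b0) //.
have coordE := orthonormal_coord (gi_lin ys) (F_orth ys)
  (fun r => F p ys (a i r \o iota)) q.
rewrite [RHS]coordE FE; last exact: a_smooth.
rewrite ys_xs AE.
(* The two mixed derivatives differ by the bracket applied to J i. *)
have bracketE := lie_bracketE (f_smoothU i p) (f_smoothU i q) xs_U
  (J_smooth i xs Logic.I).
have : lie_bracket (f i p) (f i q) xs (J i) = 0.
  have := f_involutive i p q xs xs_U; rewrite E_def => -[c ->].
  by rewrite tangent_suml big1 // => r _; rewrite /= -/(a i r xs) a0 mulr0.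
by rewrite bracketE => /eqP; rewrite subr_eq0 => /eqP <-.
Qed.
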